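(* Let $G$ be a finitely generated metabelian group such that $G$ is an extension of an abelian group $A$ by a virtually cyclic abelian group $T$ (i.e. there is a short exact sequence $1\to A\to G\to T\to 1$). Then the relative Dehn function $\tilde\delta_G$ of $G$ is polynomially bounded, i.e. there is $d\in\mathbb N$ with $\tilde\delta_G(n)\preccurlyeq n^d$. If in addition $G$ is finitely presented, then its Dehn function satisfies $\delta_G(n)\preccurlyeq 2^n$.
   Context: Dehn function: for a finite presentation $\mathcal P=\langle X\mid R\rangle$ of a group $G$ and a word $w$ over $X^{\pm 1}$ with $w=_G1$, the area of $w$ is the smallest $l$ such that $w=\prod_{i=1}^l g_i^{-1}r_ig_i$ in the free group $F(X)$ with $r_i\in R\cup R^{-1}$, $g_i\in F(X)$; $\delta_{\mathcal P}(n)$ is the supremum of the areas of words $w=_G1$ of length at most $n$. Up to $\approx$ (below) it depends only on $G$ and is denoted $\delta_G$. Relative Dehn function: let $\mathcal S_2$ be the variety of metabelian groups and $\tilde F(X)$ the free metabelian group on a finite set $X$ (the free group on $X$ modulo its second derived subgroup). A finite relative presentation $\mathcal P=\langle X\mid R\rangle_{\mathcal S_2}$ of a metabelian group $G$ consists of finite sets $X$ and $R\subseteq\tilde F(X)$ together with an epimorphism $\tilde F(X)\to G$ whose kernel is the normal closure of $R$ in $\tilde F(X)$. Every finitely generated metabelian group has such a presentation. For a word $w$ over $X^{\pm1}$ representing $1$ in $G$, the relative area is the smallest $l$ such that $w=_{\tilde F(X)}\prod_{i=1}^l g_i^{-1}r_ig_i$ with $r_i\in R\cup R^{-1}$, $g_i\in\tilde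 F(X)$. The relative Dehn function $\tilde\delta_{\mathcal P}(n)$ is the supremum of the relative areas of words $w=_G1$ with $|w|_X\le n$. Up to $\approx$ it does not depend on $\mathcal P$, and it is denoted $\tilde\delta_G$. Comparison of functions on $\mathbb N$: $f\preccurlyeq g$ means there is $C>0$ with $f(n)\le Cg(Cn)+Cn+C$ for all $n\in\mathbb N$; $f\approx g$ means $f\preccurlyeq g$ and $g\preccurlyeq f$. *)

(* Defs.v *)
From HB Require Import structures.
From mathcomp Require Import all_boot all_classical.

Set Implicit Arguments.
Unset Strict Implicit.
Unset Printing Implicit Defensive.

Local Open Scope quotient_scope.
Local Open Scope classical_set_scope.
Local Open Scope group_scope.

(** * Subgroups of a possibly infinite group, as classical sets *)

Definition subgroup (G : groupType) (H : set G) : Prop :=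
  H 1 /\ forall x y, H x -> H y -> H (x / y).

Definition normal_subgroup (G : groupType) (N : set G) : Prop :=
  subgroup N /\ forall x g, N x -> N (x ^ g).

Definition generated (G : groupType) (S : set G) : set G :=
  smallest (@subgroup G) S.

Definition normal_closure (G : groupType) (S : set G) : set G :=
  smallest (@normal_subgroup G) S.

Definition derived (G : groupType) (H : set G) : set G :=
  generated [set [~ x, y] | x in H & y in H].

Definition abelian_group (G : groupType) : Prop :=
  forall x y : G, commute x y.

Definition metabelian_group (G : groupType) : Prop :=
  derived (derived [set: G]) = [set 1].

Definition finitely_generated (G : groupType) : Prop :=
  exists2 S : set G, finite_set S & generated S = [set: G].

Definition finite_index (G : groupType) (H : set G) : Prop :=
  finite_set [set [set h * x | h in H] | x in [set: G]].

Definition virtually_cyclic (G : groupType) : Prop :=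
  exists t : G, finite_index (generated [set t]).

Definition short_exact (A G T : groupType)
    (i : {multiplicative A -> G}) (p : {multiplicative G -> T}) : Prop :=
  [/\ injective i, range i = p @^-1` [set 1] & range p = [set: T]].

(** * Words and free groups

    The letter [(x, false)] stands for the generator [x] and [(x, true)] for
    its inverse. Words need not be reduced; elements of the free group are the
    reduced words. *)

Definition letter (X : Type) : Type := (X * bool)%type.
Definition word (X : Type) : Type := seq (letter X).

Definition word_eval (X : Type) (E : groupType) (gen : X -> E) (w : word X) : E :=
  \prod_(a <- w) (if a.2 then (gen a.1)^-1 else gen a.1).

Section FreeGroup.
Variable X : choiceType.
Implicit Types (a : letter X) (u v w : word X).

Definition inv_letter a : letter X := (a.1, ~~ a.2).

Definition reduced w : bool := sorted (fun a b => b != inv_letter a) w.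

Definition push a w : word X :=
  if w is b :: w' then if b == inv_letter a then w' else a :: w else [:: a].

Definition reduce w : word X := foldr push [::] w.

Lemma inv_letterK : involutive inv_letter.
Proof. by case=> x b; rewrite /inv_letter /= negbK. Qed.

Lemma push_reduced a w : reduced w -> reduced (push a w).
Proof.
case: w => [|b w] //=; case: eqP => [_|/eqP ne]; last by rewrite /reduced /= ne.
by rewrite /reduced; exact: path_sorted.
Qed.

Lemma push_head a w : reduced (a :: w) -> push a w = a :: w.
Proof. by case: w => [|b w] //= /andP[/negbTE ->]. Qed.

Lemma pushK a w : reduced w -> push a (push (inv_letter a) w) = w.
Proof.
case: w => [|b w] red_w /=; first by rewrite eqxx.
rewrite inv_letterK; case: eqP => [eq_ba|_]; last by rewrite /= eqxx.
by rewrite -eq_ba push_head.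
Qed.

Lemma foldr_push_reduced u v : reduced v -> reduced (foldr push v u).
Proof. by move=> red_v; elim: u => //= a u; exact: push_reduced. Qed.

Lemma foldr_push_push a u v :
  reduced v -> foldr push v (push a u) = push a (foldr push v u).
Proof.
case: u => [|b u] //= red_v; case: eqP => [->|//].
by rewrite pushK ?foldr_push_reduced.
Qed.

Lemma foldr_push_foldr u v w :
  reduced w -> foldr push w (foldr push v u) = foldr push (foldr push w v) u.
Proof. by move=> red_w; elim: u => //= a u IH; rewrite foldr_push_push ?IH. Qed.

Lemma reduce_id w : reduced w -> reduce w = w.
Proof.
elim: w => //= a w IH red_aw.
by rewrite -/(reduce w) IH ?push_head //; exact: path_sorted red_aw.
Qed.

Record free_group := FreeGroup { fg_word : word X; _ : reduced fg_word }.

HB.instance Definition _ := [isSub for fg_word].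
HB.instance Definition _ := [Choice of free_group by <:].

Lemma fg_reduced (u : free_group) : reduced (fg_word u). Proof. exact: (valP u). Qed.

Definition fg_one : free_group := @FreeGroup [::] isT.
Definition fg_mul (u v : free_group) : free_group :=
  FreeGroup (foldr_push_reduced (fg_word u) (fg_reduced v)).
Definition fg_inv (u : free_group) : free_group :=
  FreeGroup (foldr_push_reduced (rev (map inv_letter (fg_word u))) (fg_reduced fg_one)).

Lemma fg_mulA : associative fg_mul.
Proof. by move=> u v w; apply/val_inj; rewrite /= foldr_push_foldr ?fg_reduced. Qed.

Lemma fg_mul1 : left_id fg_one fg_mul.
Proof. by move=> u; apply/val_inj. Qed.

Lemma fg_mulr1 : right_id fg_one fg_mul.
Proof. by move=> u; apply/val_inj; exact: reduce_id (fg_reduced u). Qed.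

Lemma fg_mulrV : right_inverse fg_one fg_inv fg_mul.
Proof.
move=> u; apply/val_inj => /=; rewrite -foldr_cat.
suff H s w : reduced w -> foldr push w (s ++ rev (map inv_letter s)) = w.
  exact: H.
elim: s w => //= a s IH w red_w.
rewrite rev_cons -cats1 catA foldr_cat /= IH ?push_reduced //.
exact: pushK.
Qed.

Lemma fg_mulV : left_inverse fg_one fg_inv fg_mul.
Proof.
move=> u; rewrite -[fg_mul _ _]fg_mulr1 -{1}(fg_mulrV (fg_inv u)) fg_mulA.
by rewrite -(fg_mulA _ u) fg_mulrV fg_mulr1 fg_mulrV.
Qed.

HB.instance Definition _ :=
  isGroup.Build free_group fg_mulA fg_mul1 fg_mulr1 fg_mulV fg_mulrV.

Definition fg_gen (x : X) : free_group := @FreeGroup [:: (x, false)] isT.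

End FreeGroup.

(** * Quotient by a normal subgroup *)

Section Quotient.
Variables (G : groupType) (N : set G).
Hypothesis nN : normal_subgroup N.
Implicit Types x y z : G.

Lemma normal1 : N 1. Proof. by case: nN => [[]]. Qed.
Lemma normalF x y : N x -> N y -> N (x / y).
Proof. by case: nN => [[_ NF] _]; exact: NF. Qed.
Lemma normalV x : N x -> N x^-1.
Proof. by move=> Nx; rewrite -div1g; exact: normalF normal1 Nx. Qed.
Lemma normalM x y : N x -> N y -> N (x * y).
Proof. by move=> Nx Ny; rewrite -[y]invgK; apply/normalF/normalV. Qed.
Lemma normalJ x g : N x -> N (x ^ g).
Proof. by case: nN => _; apply. Qed.

Definition cosetr x y : bool := `[< N (x / y) >].

Lemma cosetr_equiv : equiv_class_of cosetr.
Proof.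
split=> [x|x y|y x z]; rewrite /cosetr.
- by apply/asboolP; rewrite divgg; exact: normal1.
- by apply: asbool_equiv_eq; split=> /normalV; rewrite invgF.
- move=> /asboolP Nxy /asboolP Nyz; apply/asboolP.
  by rewrite -(divgKA y); exact: normalM.
Qed.

Canonical coset_equivRel := EquivRelPack cosetr_equiv.

Definition coset_group := {eq_quot coset_equivRel}.
HB.instance Definition _ := Choice.on coset_group.

Definition coset_pi x : coset_group := \pi_({eq_quot coset_equivRel}) x.

Lemma coset_piP x y : coset_pi x = coset_pi y <-> N (x / y).
Proof. by split=> [/eqmodP /asboolP|Nxy] //; apply/eqmodP/asboolP. Qed.

Lemma coset_reprK (c : coset_group) : coset_pi (repr c) = c.
Proof. exact: reprK. Qed.

Definition coset_one : coset_group := coset_pi 1.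
Definition coset_mul (c d : coset_group) : coset_group :=
  coset_pi (repr c * repr d).
Definition coset_inv (c : coset_group) : coset_group := coset_pi (repr c)^-1.

Lemma coset_piM x y : coset_mul (coset_pi x) (coset_pi y) = coset_pi (x * y).
Proof.
have Nrepr z : N (repr (coset_pi z) / z) by apply/coset_piP/coset_reprK.
apply/coset_piP; set a := repr _; set b := repr _.
have -> : a * b / (x * y) = (b / y) ^ a^-1 * (a / x).
  by rewrite conjgE invgK invgM !mulgA mulgVK.
by apply: normalM (Nrepr x); apply/normalJ/Nrepr.
Qed.

Lemma coset_piV x : coset_inv (coset_pi x) = coset_pi x^-1.
Proof.
apply/coset_piP; set a := repr _.
have -> : a^-1 / x^-1 = ((a / x)^-1) ^ a by rewrite conjgE invgF invgK mulgVK.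
by apply/normalJ/normalV/coset_piP/coset_reprK.
Qed.

Lemma coset_mulA : associative coset_mul.
Proof.
move=> c d e; rewrite -(coset_reprK c) -(coset_reprK d) -(coset_reprK e).
by rewrite !coset_piM mulgA.
Qed.

Lemma coset_mul1 : left_id coset_one coset_mul.
Proof. by move=> c; rewrite -(coset_reprK c) coset_piM mul1g. Qed.

Lemma coset_mulr1 : right_id coset_one coset_mul.
Proof. by move=> c; rewrite -(coset_reprK c) coset_piM mulg1. Qed.

Lemma coset_mulV : left_inverse coset_one coset_inv coset_mul.
Proof. by move=> c; rewrite -(coset_reprK c) coset_piV coset_piM mulVg. Qed.

Lemma coset_mulrV : right_inverse coset_one coset_inv coset_mul.
Proof. by move=> c; rewrite -(coset_reprK c) coset_piV coset_piM mulgV. Qed.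

HB.instance Definition _ :=
  isGroup.Build coset_group coset_mulA coset_mul1 coset_mulr1
    coset_mulV coset_mulrV.

End Quotient.

(** * Free metabelian groups *)

Section Derived.
Variable G : groupType.
Implicit Types (H S : set G).

Lemma generated_subgroup S : subgroup (generated S).
Proof.
split=> [H [[]] //|x y gx gy H [sH SH]].
by case: (sH) => _; apply; [exact: gx|exact: gy].
Qed.

Lemma generated_conj S g :
  (forall x, S x -> generated S (x ^ g)) ->
  forall x, generated S x -> generated S (x ^ g).
Proof.
move=> Sg x gx; have [g1 gF] := generated_subgroup S.
apply: (gx [set y | generated S (y ^ g)]); split=> //; split=> [|y z] /=.
  by rewrite conj1g.
by rewrite conjMg conjVg; exact: gF.
Qed.

Lemma normal_subgroupT : normal_subgroup [set: G].
Proof. by []. Qed.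

Lemma derived_normal H : normal_subgroup H -> normal_subgroup (derived H).
Proof.
move=> [_ HJ]; split=> [|x g]; first exact: generated_subgroup.
apply: generated_conj => _ [y Hy [z Hz <-]]; rewrite conjRg.
apply: sub_gen_smallest; exists (y ^ g); first exact: HJ.
by exists (z ^ g) => //; exact: HJ.
Qed.

Lemma derived2_normal : normal_subgroup (derived (derived [set: G])).
Proof. exact/derived_normal/derived_normal/normal_subgroupT. Qed.

End Derived.

Definition free_metabelian (X : choiceType) : groupType :=
  coset_group (derived2_normal (free_group X)).

Definition fm_gen (X : choiceType) (x : X) : free_metabelian X :=
  coset_pi (derived2_normal (free_group X)) (fg_gen x).

(** * Presentations, areas and Dehn functions

    These notions are stated over an arbitrary group [E] with generators
    [gen : X -> E]. Taking [E := free_group X] gives finite presentations and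
    Dehn functions; taking [E := free_metabelian X] gives their relative
    versions in the variety of metabelian groups. *)

Definition finite_presentation (E G : groupType) (R : set E)
    (phi : {multiplicative E -> G}) : Prop :=
  [/\ finite_set R, range phi = [set: G]
    & phi @^-1` [set 1] = normal_closure R].

Definition finitely_presented (G : groupType) : Prop :=
  exists (X : finType) (R : set (free_group X))
    (phi : {multiplicative free_group X -> G}), finite_presentation R phi.

(* [e] is a product of [l] conjugates of elements of [R] and their inverses;
   recall that [r ^ g = g^-1 * (r * g)]. *)
Definition relator_product (E : groupType) (R : set E) (e : E) (l : nat) : Prop :=
  exists r g : 'I_l -> E,
    (forall i, (R `|` [set s^-1 | s in R]) (r i)) /\ e = \prod_(i < l) (r i ^ g i).

(* The least [l] with [relator_product R e l]. The default value 0 is only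
   taken outside of the normal closure of [R], see [areaP] below. *)
Definition area (E : groupType) (R : set E) (e : E) : nat :=
  xget 0%N [set l | relator_product R e l /\
                    forall m, relator_product R e m -> (l <= m)%N].

Definition dehn_function (X : finType) (E G : groupType) (gen : X -> E)
    (R : set E) (phi : {multiplicative E -> G}) (n : nat) : nat :=
  \max_(k < n.+1)
    \max_(w : k.-tuple (letter X) | phi (word_eval gen w) == 1%g)
      area R (word_eval gen w).

Definition dehn_le (f g : nat -> nat) : Prop :=
  exists2 C : nat, (0 < C)%N &
    forall n, (f n <= C * g (C * n) + C * n + C)%N.

Section Area.
Variables (E : groupType) (R : set E).

Let RR : set E := R `|` [set s^-1 | s in R].

Lemma relator_product_seq e l : relator_product R e l <->
  exists s : seq (E * E), [/\ size s = l, (forall p, p \in s -> RR p.1)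
                            & e = \prod_(p <- s) (p.1 ^ p.2)].
Proof.
split=> [[r [g [rR ->]]]|[s [sz_s sR ->]]].
  exists [seq (r i, g i) | i <- index_enum 'I_l].
  split; first by rewrite size_map -sum1_size sum1_card card_ord.
    by move=> p /mapP[i _ ->]; exact: rR.
  by rewrite big_map.
exists (fun i => (nth (1, 1) s i).1), (fun i => (nth (1, 1) s i).2); split.
  by move=> i; apply/sR/mem_nth; rewrite sz_s.
by rewrite (big_nth (1, 1)) sz_s big_mkord.
Qed.

Lemma normal_closure_relator_product e :
  normal_closure R e -> exists l, relator_product R e l.
Proof.
move=> Re; pose P := [set x | exists l, relator_product R x l].
apply: (Re P); split; last first.
  move=> r Rr; exists 1%N; apply/relator_product_seq; exists [:: (r, 1)].
  by split=> // [p|]; rewrite ?inE ?big_seq1 ?conjg1 // => /eqP ->; left.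
split; first split.
- by exists 0%N; apply/relator_product_seq; exists [::]; rewrite big_nil.
- move=> x y [l /relator_product_seq[s [_ sR ->]]].
  move=> [m /relator_product_seq[t [_ tR ->]]].
  exists (size s + size t)%N; apply/relator_product_seq.
  exists (s ++ rev [seq (p.1^-1, p.2) | p <- t]); split.
  + by rewrite size_cat size_rev size_map.
  + move=> p; rewrite mem_cat mem_rev => /orP[/sR //|/mapP[q /tR Rq ->]] /=.
    case: Rq => [Rq|[z Rz <-]]; last by left; rewrite invgK.
    by right; exists q.1.
  + rewrite big_cat /= -map_rev big_map; congr (_ * _).
    rewrite -{1}[t]revK -prodgV; apply: eq_bigr => q _; exact/esym/conjVg.
- move=> x g [l /relator_product_seq[s [_ sR ->]]].
  exists (size s); apply/relator_product_seq.
  exists [seq (p.1, p.2 * g) | p <- s]; split; first by rewrite size_map.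
    by move=> p /mapP[q /sR Rq ->].
  by rewrite big_map conjg_prod; apply: eq_bigr => q _; rewrite conjgM.
Qed.

Lemma areaP e : normal_closure R e ->
  relator_product R e (area R e) /\
  forall m, relator_product R e m -> (area R e <= m)%N.
Proof.
move=> /normal_closure_relator_product[l Rl]; rewrite /area.
apply: (@xgetPex _ _ [set k | relator_product R e k /\ _]).
have exP : exists k, `[< relator_product R e k >] by exists l; apply/asboolP.
case: (ex_minnP exP) => k /asboolP Rk k_min.
by exists k; split=> // m Rm; apply/k_min/asboolP.
Qed.

End Area.

(* Main.v *)
(** Write [t] for an element of [G] whose image generates a subgroup of finite
    index of [T], chosen of infinite order there or equal to [1]. Then [A] is a
    module over [Z[t, 1/t]], finitely generated by Schreier's rewriting, which
    also turns a relation of length [n] into a sum of [O(n)] monomials with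
    exponents [O(n)] that vanishes in [A].

    Every submodule [S] of a free [Z[X]]-module of finite rank has finitely many
    generators in terms of which an element of [S] has polynomially many
    monomials. By projecting to the coordinates, this reduces to ideals of
    [Z[X]]. An ideal is [p * J], where [J] contains a positive constant [d];
    division by [p] multiplies the coefficients by at most a power of the degree
    (divide by one complex root at a time), and modulo [d] one uses finitely
    many elements of [J] of minimal degree for their leading coefficients.

    It remains to bound the cost of commuting [a] with [b ^ (t ^ c)]. In a
    metabelian group it is linear in [c]. If [G] is finitely presented, then for
    [t] or its inverse [A] is generated by the conjugates of a finite set whose
    span is stable under conjugation (Bieri and Strebel), so [b ^ (t ^ c)] is a
    word of exponential length in commuting generators. The latter is proved by
    letting the free group act on finitely many copies of [G]: the subgroup [H]
    spanned by a window of conjugates of the generators acts by right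
    multiplication, and [t] acts by right multiplication followed by a
    permutation which commutes with [H] and moves only [H], [t H] and [t^2 H].
    If neither inclusion holds, short relators act trivially, but some
    commutator of elements of [A] does not. *)

From HB Require Import structures.
Require Import Defs.
From mathcomp Require Import all_boot all_order all_algebra all_field.
From mathcomp Require Import zify.
From mathcomp Require Import all_classical.

Set Implicit Arguments.
Unset Strict Implicit.
Unset Printing Implicit Defensive.

Import Order.TTheory GRing.Theory Num.Theory.
Local Open Scope ring_scope.

(** * Submodules of free modules over the integer polynomials *)

(** The base is at least 2, so that constants and sums are absorbed by raising the exponent. *)
Definition poly_bounded (f : nat -> nat -> nat) : Prop :=
  exists c, forall n N, (f n N <= (n + N + 2) ^ c)%N.

Section PolyBounded.
Implicit Types f g : nat -> nat -> nat.
Local Open Scope nat_scope.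

Lemma poly_bounded_le f g :
  (forall n N, f n N <= g n N) -> poly_bounded g -> poly_bounded f.
Proof. by move=> fg [c gc]; exists c => n N; exact: leq_trans (fg n N) (gc n N). Qed.

Lemma poly_bounded_const k : poly_bounded (fun _ _ => k).
Proof.
exists k => n N; apply: leq_trans (ltnW (ltn_expl k (isT : 1 < 2))) _.
by case: k => // k; rewrite leq_exp2r //; lia.
Qed.

Lemma poly_bounded_l : poly_bounded (fun n _ => n).
Proof. by exists 1 => n N; lia. Qed.

Lemma poly_bounded_r : poly_bounded (fun _ N => N).
Proof. by exists 1 => n N; lia. Qed.

Lemma poly_bounded_add f g :
  poly_bounded f -> poly_bounded g -> poly_bounded (fun n N => f n N + g n N).
Proof.
move=> [c fc] [d gd]; exists (maxn c d).+1 => n N.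
set x := n + N + 2; have x2 : 1 < x by rewrite /x; lia.
have Hc : x ^ c <= x ^ maxn c d by rewrite leq_exp2l // leq_maxl.
have Hd : x ^ d <= x ^ maxn c d by rewrite leq_exp2l // leq_maxr.
have := fc n N; have := gd n N; rewrite -/x expnS => ? ?.
apply: leq_trans (leq_mul x2 (leqnn _)); lia.
Qed.

Lemma poly_bounded_mul f g :
  poly_bounded f -> poly_bounded g -> poly_bounded (fun n N => f n N * g n N).
Proof.
by move=> [c fc] [d gd]; exists (c + d) => n N; rewrite expnD leq_mul.
Qed.

Lemma poly_bounded_exp f k : poly_bounded f -> poly_bounded (fun n N => f n N ^ k).
Proof.
move=> [c fc]; exists (c * k) => n N; rewrite expnM.
by case: k => // k; rewrite leq_exp2r.
Qed.

Lemma poly_bounded_comp f g h :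
  poly_bounded f -> poly_bounded g -> poly_bounded h ->
  poly_bounded (fun n N => f (g n N) (h n N)).
Proof.
move=> [c fc] pg ph; apply: poly_bounded_le (fun n N => fc (g n N) (h n N)) _.
apply: poly_bounded_exp; apply: poly_bounded_add (poly_bounded_const 2).
exact: poly_bounded_add.
Qed.

End PolyBounded.

(** * Combinations of generators, counted by monomials *)

Section Combination.
Variable V : lmodType {poly int}.
Implicit Types (S : seq V) (f g : V).

(** [L] counts signed monomials with multiplicity, since each later stands for one use of a
    relation. The exponents are bounded separately, because they govern the cost of commutation. *)
Inductive combination S (n : nat) : nat -> V -> Prop :=
| combination0 : combination S n 0 0
| combinationS L f (b : bool) e g : combination S n L f -> (e < n)%N -> g \in S ->
    combination S n L.+1 (f + (-1) ^+ b *: ('X^e *: g)).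

Lemma combinationD S n L1 L2 f g :
  combination S n L1 f -> combination S n L2 g -> combination S n (L1 + L2) (f + g).
Proof.
move=> Cf; elim=> [|L h b e s _ IH lt_en Ss]; first by rewrite addn0 addr0.
by rewrite addnS addrA; exact: combinationS.
Qed.

Lemma combination_monomial S n (b : bool) e g :
  (e < n)%N -> g \in S -> combination S n 1 ((-1) ^+ b *: ('X^e *: g)).
Proof. by move=> lt_en Sg; rewrite -[_ *: _]add0r; apply: combinationS => //; left. Qed.

Lemma combination_scale S n (z : int) e g :
  (e < n)%N -> g \in S -> combination S n `|z| ((z *: 'X^e) *: g).
Proof.
move=> lt_en Sg.
have natP (b : bool) k : combination S n k (((-1) ^+ b * k%:Z) *: 'X^e *: g).
  elim: k => [|k IH]; first by rewrite mulr0 !scale0r; left.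
  rewrite -addn1 PoszD mulrDr !scalerDl mulr1; apply: combinationD => //.
  have -> : (((-1) ^+ b : int) *: 'X^e) *: g = (-1) ^+ b *: ('X^e *: g).
    by case: {IH} b; rewrite ?expr0 ?expr1 ?scale1r // !scaleN1r scaleNr.
  exact: combination_monomial.
case: z => k; first by have := natP false k; rewrite expr0 mul1r.
by have := natP true k.+1; rewrite expr1 mulN1r NegzE abszN.
Qed.

Lemma combination_sub S S' n n' L f : {subset S <= S'} -> (n <= n')%N ->
  combination S n L f -> combination S' n' L f.
Proof.
move=> sSS' le_nn'; elim=> [|L' h b e s _ IH lt_en Ss]; first by left.
by apply: combinationS IH _ (sSS' _ Ss); exact: leq_trans le_nn'.
Qed.

End Combination.

Lemma combination_map (V W : lmodType {poly int}) (h : {linear V -> W}) S n L f :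
  combination S n L f -> combination (map h S) n L (h f).
Proof.
elim=> [|L' g b e s _ IH lt_en Ss]; first by rewrite linear0; left.
rewrite linearD linearZ linearZ /=; apply: combinationS => //; exact: map_f.
Qed.

Definition coef_bounded (n N : nat) (p : {poly int}) : Prop :=
  (size p <= n)%N /\ forall i : nat, (absz (p`_i)%R <= N)%N.

Definition submodule (V : lmodType {poly int}) (S : V -> Prop) : Prop :=
  S 0 /\ forall (q : {poly int}) f g, S f -> S g -> S (q *: f + g).

Section Submodule.
Variables (V : lmodType {poly int}) (S : V -> Prop).
Hypothesis subS : submodule S.

Lemma submodule_scale q f : S f -> S (q *: f).
Proof. by move=> Sf; rewrite -[_ *: _]addr0; apply: subS.2 => //; exact: subS.1. Qed.

Lemma submodule_add f g : S f -> S g -> S (f + g).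
Proof. by move=> Sf Sg; rewrite -[f]scale1r; exact: subS.2. Qed.

Lemma submodule_sub f g : S f -> S g -> S (f - g).
Proof. by move=> Sf Sg; rewrite addrC -scaleN1r; exact: subS.2. Qed.

Lemma submodule_combination (gens : seq V) n L f :
  (forall g, g \in gens -> S g) -> combination gens n L f -> S f.
Proof.
move=> gS; elim=> [|L' h b e s _ IH _ /gS Ss]; first exact: subS.1.
by apply: submodule_add => //; do 2 apply: submodule_scale.
Qed.

End Submodule.

(** The number of monomials may grow polynomially, but exponents exceed [n] only by a constant: for
    finitely presented groups they enter the cost of commutation exponentially. *)
Definition tame (V : lmodType {poly int}) (bounded : nat -> nat -> V -> Prop)
    (S : V -> Prop) : Prop :=
  exists (gens : seq V) (k : nat) (F : nat -> nat -> nat),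
    [/\ forall g, g \in gens -> S g, poly_bounded F
      & forall n N f, S f -> bounded n N f ->
          exists2 L, (L <= F n N)%N & combination gens (n + k) L f].

Definition ideal_bounded n N (p : {poly int}^o) := coef_bounded n N p.

Section CoefBounded.
Implicit Types p q : {poly int}.

Lemma coef_boundedW n N n' N' p : (n <= n')%N -> (N <= N')%N ->
  coef_bounded n N p -> coef_bounded n' N' p.
Proof. by move=> nn NN [sp cp]; split=> [|i]; [exact: leq_trans nn|exact: leq_trans NN]. Qed.

Lemma coef_boundedD n N M p q : coef_bounded n N p -> coef_bounded n M q ->
  coef_bounded n (N + M) (p + q).
Proof.
move=> [sp cp] [sq cq]; split=> [|i].
  by apply: leq_trans (size_polyD _ _) _; rewrite geq_max sp.
by rewrite coefD; move: (p`_i) (q`_i) (cp i) (cq i) => x y; lia.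
Qed.

Lemma coef_boundedN n N p : coef_bounded n N p -> coef_bounded n N (- p).
Proof. by move=> [sp cp]; split=> [|i]; rewrite ?size_polyN // coefN abszN. Qed.

Lemma coef_bounded_monomial n N e (b : bool) p : coef_bounded n N p ->
  coef_bounded (e + n) N ((-1) ^+ b *: ('X^e *: (p : {poly int}^o)) : {poly int}^o).
Proof.
move=> bp.
have: coef_bounded (e + n) N ('X^e * p).
  case: bp => sp cp; split=> [|i].
    by apply: leq_trans (size_polyMleq _ _) _; rewrite size_polyXn addSn leq_add2l.
  by rewrite coefXnM; case: ifP.
case: b; rewrite ?expr0 ?expr1 ?scale1r // scaleN1r; exact: coef_boundedN.
Qed.

Lemma coef_bounded_exists (s : seq {poly int}) :
  exists k, forall p, p \in s -> coef_bounded k k p.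
Proof.
elim: s => [|p s [k sk]]; first by exists 0%N.
exists (k + size p + \max_(i < size p) absz (p`_i)%R)%N => q; rewrite inE => /orP[/eqP -> | /sk].
  split=> [|i]; first by lia.
  case: (ltnP i (size p)) => [lt_ip|le_pi]; last by rewrite nth_default.
  have := @leq_bigmax _ (fun j : 'I_(size p) => absz (p`_j)%R) (Ordinal lt_ip) => /=; lia.
by apply: coef_boundedW; lia.
Qed.

End CoefBounded.

(** * Ideals of the integer polynomials *)

Lemma coef_bounded_pred n N (p : {poly int}) : (size p <= n.+1)%N -> p`_n = 0 ->
  (forall i : nat, (i < n)%N -> (absz (p`_i)%R <= N)%N) -> coef_bounded n N p.
Proof.
move=> sp pn0 cp; have sz : (size p <= n)%N.
  apply/leq_sizeP => j; rewrite leq_eqVlt => /orP[/eqP <- //|lt_nj].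
  by rewrite nth_default // (leq_trans sp).
split=> // i; case: (ltnP i n) => [/cp //|le_ni].
by rewrite nth_default // (leq_trans sz).
Qed.

Lemma exists_min_size (P : {poly int} -> Prop) : (exists p, P p) ->
  exists2 p, P p & forall q, P q -> (size p <= size q)%N.
Proof.
move=> [p0 Pp0]; have exP : exists k, `[< exists2 p, P p & size p = k >].
  by exists (size p0); apply/asboolP; exists p0.
case: (ex_minnP exP) => k /asboolP[p Pp <-] min_p; exists p => // q Pq.
by apply: min_p; apply/asboolP; exists q.
Qed.

Lemma absz_divz_le (x : int) (d : nat) : (0 < d)%N -> (absz (x %/ d)%Z <= absz x)%N.
Proof.
move=> d_gt0; have := divz_eq x d; have := ltz_pmod x (_ : (0 < d%:Z)%R).
have := modz_ge0 x (_ : d%:Z != 0).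
move: (x %/ d)%Z (x %% d)%Z => q r /(_ _) Hr /(_ _) Hr2 Hx.
have {}Hr : 0 <= r by apply: Hr; lia.
have {}Hr2 : r < d by apply: Hr2; lia.
nia.
Qed.

(** Induction on the degree. The top coefficient is reduced modulo [d] by a multiple of the
    constant, then removed by a shift of an element of [J] with that leading coefficient. Only the
    second subtraction affects lower coefficients, by at most [M]. *)
Lemma tame_ideal_const (J : {poly int}^o -> Prop) (d : nat) :
  submodule J -> (0 < d)%N -> J (d%:Z)%:P -> tame ideal_bounded J.
Proof.
move=> subJ d_gt0 Jd.
(* Least size ensures that aligning [g c] with a given element takes a nonnegative shift. The value
   0 is a default for [c] that is no leading coefficient. *)
have /choice[g gP] : forall c : nat, exists g : {poly int}, J g /\
    forall f, J f -> lead_coef f = c -> lead_coef g = c /\ (size g <= size f)%N.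
  move=> c; have [ex|nex] := pselect (exists f : {poly int}, J f /\ lead_coef f = c).
    have [p [Jp pc] p_min] := exists_min_size ex.
    by exists p; split=> // f Jf fc; split=> //; exact: p_min.
  by exists 0; split=> [|f Jf fc]; [exact: subJ.1|case: nex; exists f].
pose gens : seq {poly int}^o := (d%:Z)%:P :: [seq g c | c <- iota 0 d].
have [M MP] := coef_bounded_exists gens.
(* There are [n] steps, during which coefficients stay at most [N + n * M]; each step uses at most
   that many copies of [d] and one shifted element. *)
exists gens, 0%N, (fun n N => n * (N + n * M + 1))%N; split.
- by move=> h; rewrite inE => /orP[/eqP -> //|/mapP[c _ ->]]; exact: (gP c).1.
- apply: poly_bounded_mul poly_bounded_l _; do 2?apply: poly_bounded_add.
  + exact: poly_bounded_r.
  + exact: poly_bounded_mul poly_bounded_l (poly_bounded_const _).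
  + exact: poly_bounded_const.
move=> n; rewrite addn0; elim: n => [|n IH] N f Jf [sf cf].
  exists 0%N => //; have -> : f = 0 by apply/eqP; rewrite -size_poly_eq0 -leqn0.
  exact: combination0.
pose e := (f`_n %/ d)%Z; pose c := (f`_n %% d)%Z.
have fnE : f`_n = e * d + c := divz_eq _ _.
have c_ge0 : 0 <= c by apply: modz_ge0; lia.
have c_ltd : c < d by apply: ltz_pmod; lia.
have leeN : (absz e <= N)%N by apply: leq_trans (absz_divz_le _ d_gt0) (cf n).
pose u : {poly int}^o := (e *: 'X^n : {poly int}) *: ((d%:Z)%:P : {poly int}^o).
have uE i : u`_i = if i == n then e * d else 0.
  rewrite /u coefMC coefZ coefXn; case: eqP => _; last by rewrite mulr0 mul0r.
  by rewrite mulr1.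
have Cu : combination gens n.+1 `|e| u by apply: combination_scale; rewrite ?inE ?eqxx.
pose f1 : {poly int}^o := f - u.
have Jf1 : J f1 by apply: submodule_sub => //; exact: submodule_scale.
have f1n : f1`_n = c by rewrite coefB uE eqxx fnE; lia.
have f1E i : i != n -> f1`_i = f`_i by move=> /negbTE ne; rewrite coefB uE ne subr0.
have sf1 : (size f1 <= n.+1)%N.
  apply/leq_sizeP => j lt_nj; rewrite f1E; first by move/leq_sizeP: sf; exact.
  by rewrite neq_ltn lt_nj orbT.
have fE : f = f1 + u by rewrite /f1 subrK.
have [c0|c_neq0] := eqVneq c 0.
  have [|L leL CL] := IH N f1 Jf1.
    apply: coef_bounded_pred => //; first by rewrite f1n.
    by move=> i lt_in; rewrite f1E ?cf // neq_ltn lt_in.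
  exists (L + `|e|)%N; first by nia.
  by rewrite fE; apply: combinationD Cu; exact: combination_sub CL.
have sz1 : size f1 = n.+1.
  apply/eqP; rewrite eqn_leq sf1 ltnNge; apply/negP => /leq_sizeP/(_ n (leqnn _)).
  by rewrite f1n; apply/eqP.
have lc1 : lead_coef f1 = `|c|%N by rewrite lead_coefE sz1 f1n; lia.
have [Jg /(_ f1 Jf1 lc1)[lcg]] := gP `|c|%N; rewrite sz1 => szg.
set h := g _ in Jg lcg szg.
have Gh : h \in gens.
  by rewrite inE; apply/orP; right; apply: map_f; rewrite mem_iota; lia.
have h_gt0 : (0 < size h)%N.
  by rewrite lt0n size_poly_eq0 -lead_coef_eq0 lcg; lia.
have [_ ch] := MP _ Gh.
move sE: (size h) => s in szg h_gt0.
(* The leading terms of [v] and [f1] agree: same degree, and leading coefficient [c]. *)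
pose v : {poly int}^o := ('X^(n.+1 - s) : {poly int}) *: (h : {poly int}^o).
have vE i : v`_i = if (i < n.+1 - s)%N then 0 else h`_(i - (n.+1 - s)).
  by rewrite coefXnM.
have [||L leL CL] := IH (N + M)%N (f1 - v).
- by apply: submodule_sub => //; exact: submodule_scale.
- apply: coef_bounded_pred.
  + apply/leq_sizeP => j lt_nj; rewrite coefB vE ltnNge (leq_trans _ lt_nj) ?leq_subr //=.
    move/leq_sizeP: sf1 => -> //; rewrite nth_default ?subr0 // sE; lia.
  + rewrite coefB f1n vE ifN; last by rewrite -leqNgt; lia.
    have -> : (n - (n.+1 - s) = (s).-1)%N by lia.
    by rewrite -sE -lead_coefE lcg; lia.
  + move=> i lt_in; have neq_in : i != n by rewrite neq_ltn lt_in.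
    rewrite coefB f1E // vE; case: ifP => _.
      by rewrite subr0; exact: leq_trans (cf i) (leq_addr _ _).
    have := cf i; have := ch (i - (n.+1 - s))%N.
    by move: (f`_i) (h`__) => x y; lia.
exists (L + 1 + `|e|)%N; first by nia.
rewrite fE; apply: combinationD Cu; rewrite -[f1](subrK v).
apply: combinationD; first exact: combination_sub CL.
have lt_e : (n.+1 - s < n.+1)%N by lia.
have := combination_monomial false lt_e (Gh : (h : {poly int}^o) \in gens).
by rewrite expr0 scale1r.
Qed.
(* According to [|z| <= 1] or not, the recurrence
   [f_(i+1) = q_i - z * q_(i+1)] is solved downwards or upwards. *)
Lemma quotient_linear_bounded (z : algC) (q : {poly algC}) (n : nat) (B : algC) :
  (size (('X - z%:P) * q)%R <= n)%N ->
  (forall i : nat, `|(('X - z%:P) * q)`_i| <= B) ->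
  (size q <= n)%N /\ forall i : nat, `|q`_i| <= B *+ n.
Proof.
set f := _ * q => sf cf.
have B_ge0 : 0 <= B by apply: le_trans (cf 0%N); exact: normr_ge0.
have [->|q_neq0] := eqVneq q 0.
  by rewrite size_poly0; split=> // i; rewrite coef0 normr0 mulrn_wge0.
have szf : size f = (size q).+1.
  by rewrite /f size_monicM ?monicXsubC // size_XsubC.
have sq : (size q < n)%N by rewrite -szf.
have f0 : f`_0 = - (z * q`_0).
  by rewrite /f mulrBl coefB coefXM coefCM sub0r.
have fS i : f`_i.+1 = q`_i - z * q`_i.+1.
  by rewrite /f mulrBl coefB coefXM coefCM.
split=> [|i]; first exact: ltnW.
have B_mono a b : (a <= b)%N -> B *+ a <= B *+ b.
  by move=> /subnKC <-; rewrite mulrnDr lerDl mulrn_wge0.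
case: (ltnP i n) => [lt_in|le_ni]; last first.
  by rewrite nth_default ?normr0 ?mulrn_wge0 //; exact: ltnW (leq_trans sq _).
have [z_le1|z_gt1] := real_leP (normr_real z) (real1 _).
- have down k : `|q`_(n - k)| <= B *+ k.
    elim: k => [|k IH].
      by rewrite subn0 nth_default ?normr0 ?mulrn_wge0 //; exact: ltnW.
    case: (ltnP k n) => [lt_kn|le_nk]; last first.
      have -> : (n - k.+1 = n - k)%N by lia.
      exact: le_trans IH (B_mono _ _ (leqnSn k)).
    have nkE : (n - k = (n - k.+1).+1)%N by lia.
    have -> : q`_(n - k.+1) = f`_(n - k) + z * q`_(n - k) by rewrite nkE fS subrK.
    apply: le_trans (ler_normD _ _) _; rewrite mulrS lerD // normrM.
    by apply: le_trans IH; rewrite ler_piMl.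
  have := down (n - i)%N; rewrite (subKn (ltnW lt_in)) => h; apply: le_trans h _.
  by apply: B_mono; exact: leq_subr.
have z_gt0 : 0 < `|z| by apply: lt_trans z_gt1.
have step (x y : algC) c : `|x| <= c -> x = z * y -> `|y| <= c.
  move=> xc xE; apply: le_trans xc; rewrite xE normrM ler_peMl //; exact: ltW.
have up k : `|q`_k| <= B *+ k.+1.
  elim: k => [|k IH]; first by apply: (step (- f`_0)); rewrite ?normrN // f0 opprK.
  apply: (step (q`_k - f`_k.+1)); last by rewrite fS opprB addrCA subrr addr0.
  by apply: le_trans (ler_normB _ _) _; rewrite mulrSr lerD.
by apply: le_trans (up i) _; exact: B_mono.
Qed.

Lemma quotient_split_bounded (rs : seq algC) (q : {poly algC}) (n : nat) (B : algC) :
  (size (\prod_(z <- rs) ('X - z%:P) * q)%R <= n)%N ->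
  (forall i : nat, `|(\prod_(z <- rs) ('X - z%:P) * q)`_i| <= B) ->
  (size q <= n)%N /\ forall i : nat, `|q`_i| <= B *+ (n ^ size rs).
Proof.
elim: rs B => [|z rs IH] B; first by rewrite big_nil mul1r expn0.
rewrite big_cons -mulrA => sf cf.
have [sq cq] := quotient_linear_bounded sf cf.
have [s c] := IH _ sq cq; split=> // i.
by rewrite /= expnS mulrnA.
Qed.

(** Over the algebraic numbers [p] splits into linear factors, and dividing by each costs a factor
    [n]. The leading coefficient is a nonzero integer, so dividing by it does not increase absolute
    values. *)
Lemma quotient_bounded (p : {poly int}) : p != 0 ->
  exists k : nat, forall q n N, coef_bounded n N (p * q) ->
    coef_bounded n (N * n ^ k)%N q.
Proof.
move=> p_neq0; pose m (r : {poly int}) := map_poly (intr : int -> algC) r.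
have [rs rsE] := closed_field_poly_normal (m p).
have mE r i : (m r)`_i = (r`_i)%:~R by rewrite coef_map.
have szm r : size (m r) = size r.
  by apply: size_map_inj_poly => //; exact: intr_inj.
set l := lead_coef _ in rsE.
have l_ge1 : 1 <= `|l|.
  rewrite /l lead_coefE mE szm -lead_coefE -intr_norm ler1z.
  by rewrite -gtz0_ge1 normr_gt0 lead_coef_eq0.
exists (size rs) => q n N [spq cpq].
have normE (x : int) (M : nat) : (absz x <= M)%N = (`|x%:~R : algC| <= M%:R).
  by rewrite -intr_norm -abszE -pmulrn ler_nat.
have prodE : \prod_(z <- rs) ('X - z%:P) * (l *: m q) = m (p * q).
  by rewrite -scalerAr scalerAl -rsE /m rmorphM.
have [||sq cq] := @quotient_split_bounded rs (l *: m q) n N%:R; rewrite ?prodE ?szm //.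
  by move=> i; rewrite mE -normE.
have l_neq0 : l != 0 by rewrite -normr_gt0; exact: lt_le_trans l_ge1.
move: sq; rewrite size_scale // szm => sq; split=> // i.
rewrite normE natrM -mE mulr_natr; apply: le_trans (cq i).
by rewrite coefZ normrM ler_peMl.
Qed.

(** By pseudo-division, a nonzero [g] of least degree divides every element up to an integer factor;
    by Gauss's lemma its primitive part [p] divides them over the integers. The quotients form an
    ideal that contains the absolute value of the content of [g]. *)
Lemma tame_ideal (I : {poly int}^o -> Prop) : submodule I -> tame ideal_bounded I.
Proof.
move=> subI; have [[f0 [If0 f0_neq0]]|I0] :=
    pselect (exists f : {poly int}, I f /\ f != 0); last first.
  exists [::], 0%N, (fun _ _ => 0%N); split=> [//||n N f If _].
    exact: poly_bounded_const.
  exists 0%N => //; have -> : f = 0; last exact: combination0.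
  by apply/eqP; apply: contra_notT I0 => f_neq0; exists f.
have exP : exists f, I f /\ f != 0 by exists f0.
have [g [Ig g_neq0] g_min] := exists_min_size exP.
have g_dvd f : I f -> {q | f = zprimitive g * q}.
  move=> If; apply: dvdpP_int; rewrite /dvdp; apply/eqP.
  have H : ~ (I (f %% g)%R /\ (f %% g)%R != 0).
    by move=> /g_min; rewrite leqNgt => /negP; apply; rewrite ltn_modp.
  apply/eqP; apply: contra_notT H => md_neq0; split=> //.
  have -> : (f %% g)%R = lead_coef g ^+ scalp f g *: f - f %/ g * g.
    by rewrite Pdiv.Idomain.divp_eq addrC addKr.
  rewrite -mul_polyC; apply: (submodule_sub subI); first exact: (submodule_scale subI).
  exact: (submodule_scale subI).
set p := zprimitive g in g_dvd.
have p_neq0 : p != 0 by rewrite zprimitive_eq0.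
pose J : {poly int}^o -> Prop := fun q => I (p * q).
have subJ : submodule J.
  split=> [|q f h Jf Jh]; first by rewrite /J mulr0; exact: subI.1.
  by rewrite /J mulrDr mulrCA; exact: subI.2.
have Jd : J (`|zcontents g|%N%:Z)%:P.
  have pc : p * (zcontents g)%:P = g by rewrite mulrC mul_polyC -zpolyEprim.
  rewrite /J abszE; case: (ler0P (zcontents g)) => _; last by rewrite pc.
  by rewrite polyCN mulrN pc -mulN1r; exact: (submodule_scale subI).
have d_gt0 : (0 < `|zcontents g|)%N by rewrite absz_gt0 zcontents_eq0.
have [gens [k [F [gensJ polF gensP]]]] := tame_ideal_const subJ d_gt0 Jd.
have [e eP] := quotient_bounded p_neq0.
pose h : {linear {poly int}^o -> {poly int}^o} := p \*o idfun.
exists [seq p * r | r <- gens], k, (fun n N => F n (N * n ^ e)%N); split.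
- by move=> _ /mapP[r /gensJ Jr ->].
- apply: (poly_bounded_comp polF poly_bounded_l).
  apply: poly_bounded_mul poly_bounded_r _.
  exact: poly_bounded_exp poly_bounded_l.
move=> n N f If; have [q fE] := g_dvd f If; move: If; rewrite fE => Jq bf.
have [L leL CL] := gensP _ _ _ Jq (eP _ _ _ bf).
by exists L => //; exact: (combination_map h CL).
Qed.

(** * Submodules of free modules of finite rank *)

Section TameModule.
Variable J : finType.
Notation V := {ffun J -> {poly int}^o}.

Definition vec_bounded n N (f : V) : Prop := forall j, coef_bounded n N (f j).

(** Lifting each generator keeps the number of monomials, and this number bounds the other
    coordinates of the lift. *)
Lemma combination_lift (j : J) (gens : seq {poly int}^o) (s : {poly int}^o -> V) n M L g :
  (forall h, h \in gens -> s h j = h /\ vec_bounded M M (s h)) ->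
  combination gens n L g ->
  exists f : V, [/\ combination (map s gens) n L f, f j = g
                  & vec_bounded (n + M) (L * M)%N f].
Proof.
move=> sP; elim=> [|L' h b e r _ [f [Cf fj bf]] lt_en gr].
  exists 0; split; [exact: combination0|by rewrite ffunE|].
  by move=> i; rewrite ffunE; split=> [|k]; rewrite ?size_poly0 // coef0.
exists (f + (-1) ^+ b *: ('X^e *: s r)); have [srj bsr] := sP _ gr; split.
- by apply: combinationS => //; exact: map_f.
- by rewrite !ffunE fj srj.
move=> i; rewrite !ffunE mulSnr; apply: coef_boundedD (bf i) _.
apply: coef_boundedW (coef_bounded_monomial e b (bsr i)) => //.
by rewrite leq_add2r ltnW.
Qed.

(** Induction on the coordinates that may be nonzero. The values at [j] form an ideal; subtracting a
    lifted combination leaves an element of [S] that vanishes at [j]. *)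
Lemma tame_support (l : seq J) (S : V -> Prop) : submodule S ->
  (forall f, S f -> forall j, j \notin l -> f j = 0) -> tame vec_bounded S.
Proof.
elim: l S => [|j l IH] S subS suppS.
  exists [::], 0%N, (fun _ _ => 0%N); split=> [//||n N f Sf _].
    exact: poly_bounded_const.
  exists 0%N => //; have -> : f = 0; last exact: combination0.
  by apply/ffunP => i; rewrite ffunE (suppS f Sf).
pose I (q : {poly int}^o) := exists2 f, S f & f j = q.
have subI : submodule I.
  split=> [|q f h [f' Sf' <-] [h' Sh' <-]]; first by exists 0; rewrite ?ffunE //; exact: subS.1.
  by exists (q *: f' + h'); rewrite ?ffunE //; exact: subS.2.
pose S' f := S f /\ f j = 0.
have subS' : submodule S'.
  split=> [|q f h [Sf f0] [Sh h0]]; first by split; rewrite ?ffunE //; exact: subS.1.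
  by split; rewrite ?ffunE ?f0 ?h0 ?scaler0 ?addr0 //; exact: subS.2.
have suppS' f : S' f -> forall i, i \notin l -> f i = 0.
  move=> [Sf fj] i il; have [->//|neq_ij] := eqVneq i j.
  by apply: suppS => //; rewrite inE negb_or neq_ij.
have [gens' [k' [F' [gensS' polF' gensP']]]] := IH _ subS' suppS'.
have [gens [k [F [gensI polF gensP]]]] := tame_ideal subI.
have /choice[s sP] : forall h : {poly int}^o, exists f, h \in gens -> S f /\ f j = h.
  move=> h; have [/gensI[f Sf fj]|nh] := boolP (h \in gens); first by exists f.
  by exists 0.
have [M MP] := coef_bounded_exists [seq s h i | h <- gens, i <- enum J].
have sM h : h \in gens -> vec_bounded M M (s h).
  by move=> gh i; apply: MP; apply/allpairsP; exists (h, i); rewrite mem_enum.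
exists (map s gens ++ gens'), (k + M + k')%N.
(* Clearing the coordinate [j] takes at most [F n N] monomials. The remainder has size at most
   [n + (k + M)] and coefficients at most [N + F n N * M]. *)
exists (fun n N => F n N + F' (n + (k + M)) (N + F n N * M))%N; split.
- move=> f; rewrite mem_cat => /orP[/mapP[h gh ->]|/gensS'[]//].
  by have [] := sP h gh.
- apply: poly_bounded_add => //; apply: poly_bounded_comp => //.
    exact: poly_bounded_add poly_bounded_l (poly_bounded_const _).
  apply: poly_bounded_add poly_bounded_r _.
  exact: poly_bounded_mul polF (poly_bounded_const _).
move=> n N f Sf bf.
have [L leL CL] := gensP n N (f j) (ex_intro2 _ _ f Sf erefl) (bf j).
have [|f' [Cf' f'j bf']] := @combination_lift j gens s (n + k) M L (f j) _ CL.
  by move=> h gh; split; [exact: (sP h gh).2|exact: sM].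
have Sf' : S f'.
  apply: submodule_combination Cf' => // _ /mapP[h gh ->].
  exact: (sP h gh).1.
have [||L' leL' CL'] := gensP' (n + (k + M))%N (N + F n N * M)%N (f - f').
- by split; [exact: submodule_sub|rewrite !ffunE f'j subrr].
- move=> i; rewrite !ffunE; apply: coef_boundedD.
    by apply: coef_boundedW (bf i) => //; exact: leq_addr.
  apply: coef_boundedN; apply: coef_boundedW (bf' i); first by rewrite addnA.
  by rewrite leq_mul2r leL orbT.
exists (L + L')%N; first exact: leq_add.
rewrite -[f](subrK f') addrC; apply: combinationD.
  by apply: combination_sub Cf' => [h hin|]; rewrite ?mem_cat ?hin //; lia.
by apply: combination_sub CL' => [h hin|]; rewrite ?mem_cat ?hin ?orbT //; lia.
Qed.

Theorem tame_module (S : V -> Prop) : submodule S -> tame vec_bounded S.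
Proof. by move=> subS; apply: (@tame_support (enum J)) => // f _ j; rewrite mem_enum. Qed.

End TameModule.

Local Close Scope ring_scope.
Local Open Scope classical_set_scope.
Local Open Scope group_scope.

(** * Equality up to a bounded number of relators *)

(** Turns constants found case by case into a single one. *)
Lemma uniform_bound (I : finType) (P : I -> nat -> Prop) :
  (forall i m n, (m <= n)%N -> P i m -> P i n) ->
  (forall i, exists n, P i n) -> exists n, forall i, P i n.
Proof.
move=> monP /choice[f fP]; exists (\max_i f i)%N => i.
exact: monP (leq_bigmax i) (fP i).
Qed.

Section AreaCalculus.
Variables (E : groupType) (R : set E).
Implicit Types (x y z g : E) (l : nat).

(** Unlike [area], which has the default value 0, such a bound also certifies membership in the
    normal closure, and it is monotone in [l]. *)
Definition area_le l x := exists2 m, (m <= l)%N & relator_product R x m.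

Lemma area_leW l l' x : (l <= l')%N -> area_le l x -> area_le l' x.
Proof. by move=> ll' [m ml Rx]; exists m => //; exact: leq_trans ll'. Qed.

Lemma area_le1 : area_le 0 1.
Proof. by exists 0%N => //; apply/relator_product_seq; exists [::]; rewrite big_nil. Qed.

Lemma area_leM l1 l2 x y : area_le l1 x -> area_le l2 y -> area_le (l1 + l2) (x * y).
Proof.
move=> [m1 m1l /relator_product_seq[s [ss sR ->]]].
move=> [m2 m2l /relator_product_seq[t [st tR ->]]].
exists (m1 + m2)%N; first exact: leq_add.
apply/relator_product_seq; exists (s ++ t); split; last by rewrite big_cat.
  by rewrite size_cat ss st.
by move=> q; rewrite mem_cat => /orP[/sR|/tR].
Qed.

Lemma area_leV l x : area_le l x -> area_le l x^-1.
Proof.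
move=> [m ml /relator_product_seq[s [ss sR ->]]]; exists m => //.
apply/relator_product_seq; exists (rev [seq (p.1^-1, p.2) | p <- s]); split.
- by rewrite size_rev size_map.
- move=> q; rewrite mem_rev => /mapP[r /sR Rr ->] /=.
  case: Rr => [Rr|[z Rz <-]]; last by left; rewrite invgK.
  by right; exists r.1.
rewrite -map_rev big_map -{1}[s]revK -prodgV; apply: eq_bigr => q _; exact/esym/conjVg.
Qed.

Lemma area_leJ l x g : area_le l x -> area_le l (x ^ g).
Proof.
move=> [m ml /relator_product_seq[s [ss sR ->]]]; exists m => //.
apply/relator_product_seq; exists [seq (p.1, p.2 * g) | p <- s]; split.
- by rewrite size_map.
- by move=> q /mapP[r /sR Rr ->].
by rewrite big_map conjg_prod; apply: eq_bigr => q _; rewrite conjgM.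
Qed.

Lemma area_le_exists x : normal_closure R x -> exists l, area_le l x.
Proof. by move=> /normal_closure_relator_product[l Rl]; exists l, l. Qed.

Lemma area_leP l x : normal_closure R x -> area_le l x -> (area R x <= l)%N.
Proof. by move=> /areaP[_ minA] [m ml /minA am]; exact: leq_trans ml. Qed.

Definition eqa l x y := area_le l (x / y).

Lemma eqaW l l' x y : (l <= l')%N -> eqa l x y -> eqa l' x y.
Proof. exact: area_leW. Qed.

Lemma eqa_refl l x : eqa l x x.
Proof. by apply: area_leW (leq0n l) _; rewrite mulgV; exact: area_le1. Qed.

Lemma eqa_sym l x y : eqa l x y -> eqa l y x.
Proof. by move=> /area_leV; rewrite invgF. Qed.

Lemma eqa_trans l1 l2 y x z : eqa l1 x y -> eqa l2 y z -> eqa (l1 + l2) x z.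
Proof. by move=> Exy Eyz; rewrite /eqa -(divgKA y); exact: area_leM. Qed.

Lemma eqaM l1 l2 x y x' y' :
  eqa l1 x x' -> eqa l2 y y' -> eqa (l1 + l2) (x * y) (x' * y').
Proof.
move=> Ex Ey; rewrite /eqa invgM.
have -> : x * y * (y'^-1 / x') = (y / y') ^ x^-1 * (x / x').
  by rewrite conjgE invgK !mulgA mulgVK.
by rewrite addnC; apply: area_leM => //; exact: area_leJ.
Qed.

Lemma eqaMl l x y z : eqa l x y -> eqa l (z * x) (z * y).
Proof. exact: (@eqaM 0) (eqa_refl 0 z). Qed.

Lemma eqaMr l x y z : eqa l x y -> eqa l (x * z) (y * z).
Proof. by move=> Exy; rewrite -[l]addn0; exact: eqaM (eqa_refl 0 z). Qed.

Lemma eqaJ l x y g : eqa l x y -> eqa l (x ^ g) (y ^ g).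
Proof. by move=> /(area_leJ g); rewrite conjMg conjVg. Qed.

Lemma eqaV l x y : eqa l x y -> eqa l x^-1 y^-1.
Proof.
move=> /eqa_sym /(area_leJ x); rewrite /eqa conjgE invgK.
by rewrite -mulgA mulVg mulg1.
Qed.

Lemma eqa_eq l x y : x = y -> eqa l x y.
Proof. by move=> ->; exact: eqa_refl. Qed.

Lemma eqa1 l x : eqa l x 1 <-> area_le l x.
Proof. by rewrite /eqa divg1. Qed.

Lemma eqa_exists x y : normal_closure R (x / y) -> exists l, eqa l x y.
Proof. exact: area_le_exists. Qed.

Definition commute_a l x y := eqa l (x * y) (y * x).

Lemma commute_aW l l' x y : (l <= l')%N -> commute_a l x y -> commute_a l' x y.
Proof. exact: eqaW. Qed.

Lemma commute_a_sym l x y : commute_a l x y -> commute_a l y x.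
Proof. exact: eqa_sym. Qed.

Lemma commute_aJ l x y g : commute_a l x y -> commute_a l (x ^ g) (y ^ g).
Proof. by move=> /(eqaJ g); rewrite !conjMg. Qed.

Lemma commute_a1 l x : commute_a l x 1.
Proof. by apply: eqa_eq; rewrite mul1g mulg1. Qed.

Lemma commute_aM l1 l2 x y z :
  commute_a l1 x y -> commute_a l2 x z -> commute_a (l1 + l2) x (y * z).
Proof.
move=> xy xz; rewrite /commute_a mulgA -mulgA.
apply: (@eqa_trans _ _ (y * x * z)); first by rewrite mulgA; exact: eqaMr.
by rewrite -!mulgA; exact: eqaMl.
Qed.

Lemma commute_aV l x y : commute_a l x y -> commute_a l x y^-1.
Proof.
move=> /eqa_sym /(eqaMl y^-1) /(eqaMr y^-1).
by rewrite /commute_a !mulgA mulVg mul1g mulgK.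
Qed.

(** The replacement of [x] and [y] is paid for once on each side. *)
Lemma commute_a_eqa l1 l2 l3 x y x' y' : eqa l1 x x' -> eqa l2 y y' ->
  commute_a l3 x' y' -> commute_a (l1 + l2 + l3 + (l1 + l2)) x y.
Proof.
move=> Ex Ey Cxy; apply: eqa_trans (eqa_trans (eqaM Ex Ey) Cxy) _.
by rewrite [(l1 + l2)%N]addnC; apply: eqa_sym; exact: eqaM.
Qed.

Lemma commute_a_prod (I : eqType) l (s : seq I) (F : I -> E) x :
  (forall i, i \in s -> commute_a l x (F i)) ->
  commute_a (size s * l) x (\prod_(i <- s) F i).
Proof.
elim: s => [|i s IH] Fs; first by rewrite big_nil; exact: commute_a1.
rewrite big_cons mulSn; apply: commute_aM; first by apply: Fs; rewrite mem_head.
by apply: IH => j sj; apply: Fs; rewrite inE sj orbT.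
Qed.

End AreaCalculus.

(** With no relators the calculus is equality, so that its results apply inside a group itself. *)
Lemma eqa_set0 (E : groupType) l (x y : E) : eqa set0 l x y -> x = y.
Proof.
move=> [m _ /relator_product_seq[[|p s] [_ sR xy]]].
  by apply/divg1_eq; rewrite xy big_nil.
by have [//|[]] := sR p (mem_head _ _).
Qed.

(* The corresponding lemmas of [monoid] require a [UMagmaMorphism]. *)
Section Multiplicative.
Variables (E G : groupType) (f : {multiplicative E -> G}).

Lemma morph1 : f 1 = 1.
Proof. by apply: (mulgI (f 1)); rewrite -gmulfM !mulg1. Qed.

Lemma morphV x : f x^-1 = (f x)^-1.
Proof. by apply: (mulgI (f x)); rewrite -gmulfM !mulgV morph1. Qed.

Lemma morphF x y : f (x / y) = f x / f y.
Proof. by rewrite gmulfM morphV. Qed.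

Lemma morphX n x : f (x ^+ n) = f x ^+ n.
Proof. by elim: n => [|n IH]; rewrite ?expg0 ?morph1 // !expgS gmulfM IH. Qed.

Lemma morphJ x y : f (x ^ y) = f x ^ f y.
Proof. by rewrite !conjgE !gmulfM morphV. Qed.

Lemma morphR x y : f [~ x, y] = [~ f x, f y].
Proof. by rewrite !gmulfM !morphV. Qed.

Lemma morph_prod (I : Type) (s : seq I) (F : I -> E) :
  f (\prod_(i <- s) F i) = \prod_(i <- s) f (F i).
Proof. by elim: s => [|i s IH]; rewrite ?big_nil ?morph1 // !big_cons gmulfM IH. Qed.

End Multiplicative.

(** * Words and vectors *)

(** Exponents are natural numbers, so that vectors have polynomial entries; negative exponents are
    removed by conjugating with a power of [t]. *)
Definition mletter (J : Type) : Type := (bool * nat * J)%type.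

Section MonomialWords.
Variable J : finType.
Implicit Types (x : mletter J) (W : seq (mletter J)).

(* The letter [(b, e, j)] encodes [t^e * (a j)^(+-1) * t^-e] in the group and
   the vector [+-X^e] at position [j] in the module. *)
Definition mletter_eval (E : groupType) (t : E) (a : J -> E) x : E :=
  (if x.1.1 then (a x.2)^-1 else a x.2) ^ (t ^- x.1.2).

Definition mword_eval (E : groupType) (t : E) (a : J -> E) W : E :=
  \prod_(x <- W) mletter_eval t a x.

Definition shift (d : nat) W := [seq (x.1.1, x.1.2 + d, x.2)%N | x <- W].

Definition flip x : mletter J := (~~ x.1.1, x.1.2, x.2).

Definition mword_inv W := rev (map flip W).

Section Eval.
Variables (E : groupType) (t : E) (a : J -> E).

Lemma mletter_eval_shift b e d j :
  mletter_eval t a (b, e + d, j)%N = mletter_eval t a (b, e, j) ^ (t ^- d).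
Proof. by rewrite /mletter_eval /= -conjgM -invgM -expgnDr addnC. Qed.

Lemma mletter_eval_flip x : mletter_eval t a (flip x) = (mletter_eval t a x)^-1.
Proof. by case: x => [[[] e] j]; rewrite /mletter_eval /= -conjVg ?invgK. Qed.

Lemma mword_eval_cat W1 W2 :
  mword_eval t a (W1 ++ W2) = mword_eval t a W1 * mword_eval t a W2.
Proof. by rewrite /mword_eval big_cat. Qed.

Lemma mword_eval_cons x W :
  mword_eval t a (x :: W) = mletter_eval t a x * mword_eval t a W.
Proof. by rewrite /mword_eval big_cons. Qed.

Lemma mword_eval_nil : mword_eval t a [::] = 1.
Proof. by rewrite /mword_eval big_nil. Qed.

Lemma mword_eval_shift d W :
  mword_eval t a (shift d W) = mword_eval t a W ^ (t ^- d).
Proof.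
rewrite /mword_eval big_map conjg_prod; apply: eq_bigr => -[[b e] j] _.
exact: mletter_eval_shift.
Qed.

Lemma mword_eval_inv W : mword_eval t a (mword_inv W) = (mword_eval t a W)^-1.
Proof.
rewrite /mword_eval /mword_inv -map_rev big_map -{2}[W]revK -prodgV.
by apply: eq_bigr => x _; exact: mletter_eval_flip.
Qed.

End Eval.

Lemma mword_eval_morph (E G : groupType) (f : {multiplicative E -> G})
    (t : E) (a : J -> E) W :
  f (mword_eval t a W) = mword_eval (f t) (fun j => f (a j)) W.
Proof.
rewrite /mword_eval morph_prod; apply: eq_bigr => -[[b e] j] _.
by rewrite /mletter_eval /= morphJ morphV morphX; case: b; rewrite ?morphV.
Qed.

Definition below M W := forall x, x \in W -> (x.1.2 < M)%N.

Lemma below_cat M W1 W2 : below M W1 -> below M W2 -> below M (W1 ++ W2).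
Proof. by move=> b1 b2 x; rewrite mem_cat => /orP[/b1|/b2]. Qed.

Lemma belowW M M' W : (M <= M')%N -> below M W -> below M' W.
Proof. by move=> le_MM' bW x /bW lt_xM; exact: leq_trans le_MM'. Qed.

Lemma below_shift M d W : below M W -> below (M + d) (shift d W).
Proof. by move=> bW x /mapP[y /bW lt_yM ->] /=; rewrite ltn_add2r. Qed.

Lemma below_inv M W : below M W -> below M (mword_inv W).
Proof. by move=> bW x; rewrite mem_rev => /mapP[y /bW lt_yM ->]. Qed.

Lemma size_shift d W : size (shift d W) = size W.
Proof. exact: size_map. Qed.

Lemma size_mword_inv W : size (mword_inv W) = size W.
Proof. by rewrite size_rev size_map. Qed.

Lemma below_exists W : exists M, below M W.
Proof.
elim: W => [|x W [M bW]]; first by exists 0%N.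
exists (M + x.1.2).+1 => y; rewrite inE => /orP[/eqP ->|/bW]; lia.
Qed.

Local Open Scope ring_scope.
Local Notation V := {ffun J -> {poly int}^o}.

Definition unit_vec (j : J) : V := [ffun i => (i == j)%:R].

Definition mletter_vec x : V := (-1) ^+ x.1.1 *: ('X^(x.1.2) *: unit_vec x.2).

Definition mword_vec W : V := \sum_(x <- W) mletter_vec x.

Lemma mword_vec_cat W1 W2 : mword_vec (W1 ++ W2) = mword_vec W1 + mword_vec W2.
Proof. by rewrite /mword_vec big_cat. Qed.

Lemma mword_vec_shift d W : mword_vec (shift d W) = 'X^d *: mword_vec W.
Proof.
rewrite /mword_vec big_map scaler_sumr; apply: eq_bigr => x _.
by rewrite /mletter_vec /= exprD !scalerA mulrA [_ * 'X^d]mulrC mulrA.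
Qed.

Lemma mletter_vec_flip x : mletter_vec (flip x) = - mletter_vec x.
Proof.
by case: x => [[[] e] j]; rewrite /mletter_vec /= ?expr0 ?expr1 ?scale1r ?scaleN1r ?opprK.
Qed.

Lemma mword_vec_inv W : mword_vec (mword_inv W) = - mword_vec W.
Proof.
rewrite /mword_vec /mword_inv (perm_big (map flip W)) ?perm_rev // big_map -sumrN.
by apply: eq_bigr => x _; exact: mletter_vec_flip.
Qed.

Lemma coef_mletter_vec x j (e : nat) : (mletter_vec x j)`_e =
  if (x.1.2 == e) && (x.2 == j) then (-1) ^+ x.1.1 else 0.
Proof.
case: x => [[b d] i] /=; rewrite /mletter_vec /= !ffunE.
have -> : ((-1) ^+ b *: ('X^d *: ((j == i)%:R : {poly int}^o)) : {poly int}^o) =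
    ((-1) ^+ b *+ (j == i))%:P * 'X^d.
  rewrite /GRing.scale /=; case: eqP => _; rewrite ?mulr1 ?mulr0 ?mulr0n ?mul0r ?mulr1n //.
  by case: b; rewrite ?expr0 ?expr1 ?polyCN.
rewrite coefCM coefXn (eq_sym e) (eq_sym j).
by case: (d == e); case: (i == j); rewrite ?mulr0 ?mulr1 ?mulr0n ?mul0r.
Qed.

Lemma coef_mword_vec W j (e : nat) : (mword_vec W j)`_e =
  \sum_(x <- W) (if (x.1.2 == e) && (x.2 == j) then (-1) ^+ x.1.1 else 0).
Proof.
rewrite /mword_vec sum_ffunE coef_sum.
by apply: eq_bigr => x _; exact: coef_mletter_vec.
Qed.

Lemma mword_vec_bounded M W : below M W -> vec_bounded M (size W) (mword_vec W).
Proof.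
move=> bW j; split=> [|e].
  apply/leq_sizeP => e le_Me; rewrite coef_mword_vec big1_seq // => x /andP[_ Wx].
  case: eqP => // xe; have := bW x Wx; rewrite xe; lia.
rewrite coef_mword_vec; elim: W {bW} => [|x W IH]; first by rewrite big_nil.
rewrite big_cons /=; set s := \sum_(_ <- _) _ in IH *.
by case: x.1.1; case: (_ && _); rewrite ?expr0 ?expr1; move: s IH => s; lia.
Qed.

(** Otherwise all letters with the exponent and index of [x] have its sign, and the corresponding
    coefficient is plus or minus their positive number. *)
Lemma mword_vec_eq0 W x : mword_vec W = 0 -> x \in W -> flip x \in W.
Proof.
move=> W0 Wx; apply: contraT => nWx.
have := coef_mword_vec W x.2 x.1.2; rewrite W0 ffunE coef0.
pose P := [pred y : mletter J | (y.1.2 == x.1.2) && (y.2 == x.2)].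
have signP y : y \in W -> P y -> y.1.1 = x.1.1.
  move=> Wy /andP[/eqP ye /eqP yj]; apply/eqP; apply: contraNT nWx => neq_b.
  have -> : flip x = y; last by [].
  case: y x ye yj neq_b {Wx W0 P Wy} => [[b e] j] [[b' e'] j'] /= -> ->.
  by rewrite /flip /=; case: b; case: b'.
have -> : \sum_(y <- W) (if (y.1.2 == x.1.2) && (y.2 == x.2) then (-1) ^+ y.1.1 else 0 : int) =
    (-1) ^+ x.1.1 * (count P W)%:Z.
  elim: (W) signP => [|y s IH] signP; first by rewrite big_nil mulr0.
  rewrite big_cons /= IH => [|z sz]; last by apply: signP; rewrite inE sz orbT.
  have := signP y (mem_head _ _); rewrite /=; case: (_ && _) => [->//|_].
    by rewrite PoszD mulrDr mulr1.
  by rewrite !add0r.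
have : has P W by apply/hasP; exists x; rewrite //= !eqxx.
by rewrite has_count; case: x.1.1; rewrite ?expr0 ?expr1; lia.
Qed.

Local Close Scope ring_scope.

(** The first letter is moved to its opposite and cancelled, at cost at most [size W * l]; the
    remaining word again has vector 0. *)
Lemma mword_vec0_area (E : groupType) (R : set E) (t : E) (a : J -> E) l M W :
  (forall x y, (x.1.2 < M)%N -> (y.1.2 < M)%N ->
     commute_a R l (mletter_eval t a x) (mletter_eval t a y)) ->
  below M W -> mword_vec W = 0%R -> area_le R (size W ^ 2 * l) (mword_eval t a W).
Proof.
move=> comm; have [n] := ubnP (size W); elim: n W => // n IH [|x W] lt_W bW W0.
  by rewrite mword_eval_nil; exact: area_leW (area_le1 _).
have : flip x \in W.
  have := mword_vec_eq0 W0 (mem_head x W); rewrite inE => /orP[/eqP xx|//].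
  by have := congr1 (fun y : mletter J => y.1.1) xx; rewrite /=; case: x.1.1.
move=> /splitPr WE; case: WE lt_W bW W0 => U U' lt_W bW W0.
have UU0 : mword_vec (U ++ U') = 0%R.
  rewrite -W0 /mword_vec !(big_cat, big_cons) /= mletter_vec_flip.
  by rewrite [RHS]addrCA addNKr.
have bUU : below M (U ++ U').
  by move=> y; rewrite mem_cat => /orP[Uy|Uy]; apply: bW; rewrite !(inE, mem_cat) Uy !orbT.
have := IH (U ++ U') _ bUU UU0; rewrite /= !size_cat /= in lt_W * => /(_ _) IHU.
have {}IHU := IHU (ltac:(lia)).
have CU : commute_a R (size U * l) (mletter_eval t a x) (mword_eval t a U).
  apply: commute_a_prod => y Uy; apply: comm; apply: bW.
    exact: mem_head.
  by rewrite inE mem_cat Uy orbT.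
apply/eqa1; rewrite mword_eval_cons mword_eval_cat mword_eval_cons mulgA mletter_eval_flip.
have := eqaMr ((mletter_eval t a x)^-1 * mword_eval t a U') CU.
rewrite -[X in eqa _ _ _ X]mulgA mulVKg -mword_eval_cat => /eqa_trans/(_ (iffRL (eqa1 _ _ _) IHU)).
apply: eqaW; rewrite -!mulnDl leq_mul2r; apply/orP; right.
by rewrite -!mulnn; move: (size U) (size U') => p q; nia.
Qed.

End MonomialWords.

(** * Schreier rewriting *)

Section Rewriting.
Variables (J Y I : finType) (E : groupType) (R : set E).
Variables (t : E) (a : J -> E) (y : Y -> E) (u : I -> E) (next : I -> Y -> I).
Hypothesis step : forall i v, exists (D : nat) (W : seq (mletter J)) (d l : nat),
  eqa R l (u i * y v) (t ^- D * mword_eval t a W * t ^+ d * u (next i v)).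

(** The exponent [D] can be enlarged, hence made common to all steps. *)
Lemma mword_eval_shift_exp D e W (d : nat) : t ^- D * mword_eval t a W * t ^+ d =
  t ^- (D + e) * mword_eval t a (shift e W) * t ^+ (e + d).
Proof.
by rewrite mword_eval_shift conjgE (addnC D) !expgnDr !invgM invgK !mulgA !mulgVK.
Qed.

(** The prefix [t ^+ b] travels through the word and absorbs a factor [t ^- D] at each letter, so no
    negative exponent arises; hence the condition on [b]. *)
Lemma rewrite_word : exists D c, forall w i b, (D * size w <= b)%N ->
  exists W b', [/\ (size W <= c * size w)%N, below (b + c * (size w).+1)%N W
    & eqa R (c * size w) (t ^+ b * u i * \prod_(v <- w) y v)
        (mword_eval t a W * t ^+ b' * u (foldl next i w))].
Proof.
pose P (iv : I * Y) D := exists (W : seq (mletter J)) (d l : nat),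
  eqa R l (u iv.1 * y iv.2) (t ^- D * mword_eval t a W * t ^+ d * u (next iv.1 iv.2)).
have [iv D D' le_DD' [W [d [l H]]]|iv|D DP] := @uniform_bound _ P.
- exists (shift (D' - D) W), (D' - D + d)%N, l.
  by rewrite -{1}(subnKC le_DD') -mword_eval_shift_exp.
- have [D [W [d [l H]]]] := step iv.1 iv.2.
  by exists D, W, d, l.
pose Q (iv : I * Y) c := exists (W : seq (mletter J)) d,
  [/\ (size W <= c)%N, below c W, (d <= c)%N &
   eqa R c (u iv.1 * y iv.2) (t ^- D * mword_eval t a W * t ^+ d * u (next iv.1 iv.2))].
have [iv c c' le_cc' [W [d [sW bW dc H]]]|iv|c cP] := @uniform_bound _ Q.
- exists W, d; split; [exact: leq_trans le_cc'|exact: belowW bW|exact: leq_trans le_cc'|].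
  exact: eqaW H.
- have [W [d [l H]]] := DP iv; have [M bW] := below_exists W.
  exists (size W + d + l + M)%N, W, d; split; [lia| |lia|].
    by refine (belowW _ bW); lia.
  by apply: eqaW H; lia.
exists D, c; elim=> [|v w IH] i b /=.
  exists [::], b; split=> //; rewrite big_nil mulg1 mword_eval_nil mul1g.
  exact: eqa_refl.
rewrite mulnS => le_b; have [W0 [d [sW0 bW0 le_dc H0]]] := cP (i, v).
(* After the first letter the prefix is [t ^+ (b - D + d)], still large enough for the remaining
   ones. *)
have [|W1 [b' [sW1 bW1 H1]]] := IH (next i v) (b - D + d)%N; first by lia.
exists (shift (b - D) W0 ++ W1), b'; split.
- by rewrite size_cat size_shift mulnS leq_add.
- apply: below_cat; first by refine (belowW _ (below_shift bW0)); lia.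
  by refine (belowW _ bW1); rewrite (mulnS c (size w).+1); lia.
rewrite big_cons mulnS mword_eval_cat.
have := eqaMr (\prod_(v0 <- w) y v0) (eqaMl (t ^+ b) H0); rewrite /= !mulgA => /eqa_trans; apply.
have -> : t ^+ b / t ^+ D = t ^+ (b - D) by rewrite expgnFr //; lia.
have -> : t ^+ (b - D) * mword_eval t a W0 =
    mword_eval t a (shift (b - D) W0) * t ^+ (b - D).
  by rewrite mword_eval_shift [LHS]conjgCV.
rewrite -!mulgA; apply: eqaMl; rewrite !mulgA -expgnDr.
exact: H1.
Qed.

End Rewriting.

(** * The module of relations *)

Section Relations.
Variables (J : finType) (G : groupType) (t : G) (a : J -> G).

(** One word with vector [f] is asked for, so that concatenation, inversion and shift of words give
    the module operations. *)
Definition relation_module (f : {ffun J -> {poly int}^o}) : Prop :=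
  exists2 W, mword_vec W = f & mword_eval t a W = 1.

Local Open Scope ring_scope.

Lemma relation_module_submodule : submodule relation_module.
Proof.
have S0 : relation_module 0.
  by exists [::]; [rewrite /mword_vec big_nil|exact: mword_eval_nil].
have SD f g : relation_module f -> relation_module g -> relation_module (f + g).
  move=> [W1 <- W11] [W2 <- W21]; exists (W1 ++ W2); first exact: mword_vec_cat.
  by rewrite mword_eval_cat W11 W21 mulg1.
have SN f : relation_module f -> relation_module (- f).
  move=> [W <- W1]; exists (mword_inv W); first exact: mword_vec_inv.
  by rewrite mword_eval_inv W1 invg1.
have SX f : relation_module f -> relation_module ('X *: f).
  move=> [W <- W1]; exists (shift 1 W); first by rewrite mword_vec_shift expr1.
  by rewrite mword_eval_shift W1 conj1g.
have Sn f n : relation_module f -> relation_module (f *+ n).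
  by move=> Sf; elim: n => [|n IH]; rewrite ?mulr0n // mulrS; exact: SD.
split=> // q f g Sf Sg; apply: (SD) => // {g Sg}; elim/poly_ind: q f Sf => [|q c IH] f Sf.
  by rewrite scale0r.
rewrite scalerDl -scalerA; apply: SD; first by apply: IH; exact: SX.
rewrite -[c]intz rmorph_int scaler_int.
by case: c => n; rewrite ?NegzE ?mulrNz -?pmulrn; [|apply: SN]; exact: Sn.
Qed.

(** Each generator is represented by a fixed word of finite area; signs and powers of [X] become
    inversion and conjugation, which preserve length and area. *)
Lemma relation_word (gens : seq {ffun J -> {poly int}^o}) (E : groupType)
    (R : set E) (phi : {multiplicative E -> G}) (s : E) (b : J -> E) :
  (forall e, phi e = 1%g -> normal_closure R e) -> phi s = t -> (forall j, phi (b j) = a j) ->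
  (forall g, g \in gens -> relation_module g) ->
  exists C : nat, forall n L f, combination gens n L f ->
    exists W, [/\ mword_vec W = f, (size W <= L * C)%N, below (n + C) W
                & area_le R (L * C) (mword_eval s b W)].
Proof.
move=> kerR phis phib gensS.
have {gensS}[C CP] : exists C : nat, forall g, g \in gens ->
    exists W, [/\ mword_vec W = g, (size W <= C)%N, below C W
                & area_le R C (mword_eval s b W)].
  elim: gens gensS => [|g gens IH] gensS; first by exists 0%N.
  have [|C CP] := IH; first by move=> h gh; apply: gensS; rewrite inE gh orbT.
  have [W WE W1] := gensS g (mem_head _ _); have [M bW] := below_exists W.
  have [|l lW] := @area_le_exists _ R (mword_eval s b W).
    apply: kerR; rewrite mword_eval_morph phis; rewrite -[RHS]W1.
    by congr (mword_eval _ _ _); apply/funext => j; exact: phib.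
  exists (C + size W + M + l)%N => h; rewrite inE => /orP[/eqP ->|/CP [W' [WE' sW' bW' lW']]].
    exists W; split=> //; first by lia.
      by refine (belowW _ bW); lia.
    by apply: area_leW lW; lia.
  exists W'; split=> //; first by lia.
    by refine (belowW _ bW'); lia.
  by apply: area_leW lW'; lia.
exists C => n L f; elim=> [|L' g c e h _ [W [WE sW bW lW]] lt_en gh].
  exists [::]; split=> //; first by rewrite /mword_vec big_nil.
  by rewrite mword_eval_nil; exact: area_le1.
have [W0 [WE0 sW0 bW0 lW0]] := CP h gh.
pose W1 := shift e (if c then mword_inv W0 else W0).
exists (W ++ W1); split.
- rewrite mword_vec_cat WE mword_vec_shift; congr (_ + _).
  by case: (c); rewrite ?expr1 ?expr0 ?mword_vec_inv WE0 ?scale1r ?scaleN1r // scalerN.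
- rewrite size_cat size_shift mulSnr leq_add //.
  by case: (c); rewrite ?size_mword_inv.
- apply: below_cat bW _; refine (belowW (_ : (C + e <= n + C)%N) (below_shift _)); first by lia.
  by case: (c) => //; exact: below_inv.
- rewrite mulSnr mword_eval_cat; apply: area_leM => //.
  rewrite mword_eval_shift; apply: area_leJ.
  by case: (c); rewrite ?mword_eval_inv //; exact: area_leV.
Qed.

Local Close Scope ring_scope.

(** The vector of [W] is a combination of few generators, hence the vector of a word [W'] of small
    area. Then [W] followed by the inverse of [W'] has vector 0 and is cancelled by commuting
    letters. The degree depends on the relation module alone. *)
Lemma mword_area : exists d : nat, forall (E : groupType) (R : set E)
    (phi : {multiplicative E -> G}) (s : E) (b : J -> E),
  (forall e, phi e = 1 -> normal_closure R e) -> phi s = t -> (forall j, phi (b j) = a j) ->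
  exists C : nat, forall l M N W,
    (forall x y, (x.1.2 < M + C)%N -> (y.1.2 < M + C)%N ->
       commute_a R l (mletter_eval s b x) (mletter_eval s b y)) ->
    (size W <= N)%N -> below M W -> mword_eval t a W = 1 ->
    area_le R (C * (M + N + 2) ^ d * l.+1) (mword_eval s b W).
Proof.
have [gens [k [F [gensS [c0 Fc0] gensP]]]] := tame_module relation_module_submodule.
(* With [Q = M + N + 2] both words have length of order at most [Q ^ c0 * Q], and cancellation is
   quadratic in it. *)
exists (2 * c0 + 2)%N => E R phi s b kerR phis phib.
have [C CP] := relation_word kerR phis phib gensS.
exists (k + C + (C.+1 * C.+1))%N => l M N W comm sW bW W1.
have bvec : vec_bounded M N (mword_vec W).
  by move=> j; apply: coef_boundedW (mword_vec_bounded bW j).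
have [|L leL /CP[W' [WE' sW' bW' lW']]] := gensP M N (mword_vec W) _ bvec.
  by exists W.
pose U := W ++ mword_inv W'.
have := @mword_vec0_area _ _ R s b l (M + (k + C + (C.+1 * C.+1)))%N U comm.
have bU : below (M + (k + C + (C.+1 * C.+1)))%N U.
  apply: below_cat; first by refine (belowW _ bW); exact: leq_addr.
  by refine (belowW _ (below_inv bW')); lia.
have U0 : mword_vec U = 0%R by rewrite mword_vec_cat mword_vec_inv WE' subrr.
move=> /(_ bU U0); rewrite mword_eval_cat mword_eval_inv => lU.
have := area_leM lU lW'; rewrite mulgVK; apply: area_leW.
rewrite size_cat size_mword_inv.
set Q := (M + N + 2)%N; have Q1 : (1 < Q)%N by rewrite /Q; lia.
have {}leL : (L <= Q ^ c0)%N := leq_trans leL (Fc0 M N).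
have leN : (N <= Q)%N by rewrite /Q; lia.
have P1 : (0 < Q ^ c0)%N by rewrite expn_gt0; lia.
rewrite expnD [(2 * c0)%N]mulnC expnM; move: (Q ^ c0)%N P1 leL => P P1 leL.
have sWW' : (size W + size W' <= P * Q * C.+1)%N.
  apply: leq_trans (leq_add sW sW') _.
  apply: (@leq_trans (P * Q + P * Q * C)); last by rewrite mulnS.
  apply: leq_add; first by apply: leq_trans leN _; rewrite leq_pmull.
  by rewrite leq_mul2r; apply/orP; right; apply: leq_trans leL _; rewrite leq_pmulr // ltnW.
have sqWW' := leq_mul sWW' sWW'.
have leLC : (L * C <= P ^ 2 * Q ^ 2 * C)%N.
  rewrite leq_mul2r; apply/orP; right; apply: leq_trans leL _.
  by rewrite -!mulnn -!mulnA leq_pmulr // !muln_gt0 P1 ltnW.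
rewrite -mulnn; apply: leq_trans (leq_add (leq_mul sqWW' (leqnn l)) leLC) _.
rewrite -!mulnn; set X := (P * P * (Q * Q))%N.
have -> : (P * Q * C.+1 * (P * Q * C.+1) = X * (C.+1 * C.+1))%N.
  by rewrite mulnACA (mulnACA P).
have H : (C.+1 * C.+1 * l + C <= (k + C + C.+1 * C.+1) * l.+1)%N by nia.
rewrite -(mulnA X) -mulnDr; apply: leq_trans (leq_mul (leqnn X) H) _.
by rewrite mulnCA mulnA.
Qed.

End Relations.

(** * Transversals and generators of the kernel *)

Lemma generated1P (T : groupType) (s z : T) :
  generated [set s] z -> exists m n, z = s ^- m * s ^+ n.
Proof.
move=> /(_ [set z | exists m n, z = s ^- m * s ^+ n]); apply; split; last first.
  by move=> _ ->; exists 0%N, 1%N; rewrite expg0 expg1 invg1 mul1g.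
split; first by exists 0%N, 0%N; rewrite !expg0 invg1 mul1g.
move=> _ _ [m [n ->]] [m' [n' ->]]; exists (m + n')%N, (n + m')%N.
have comm i j : s ^+ i * s ^- j = s ^- j * s ^+ i.
  by apply/esym/commute_sym/commuteV/commuteX2.
rewrite invgM invgK !expgnDr invgM !mulgA; congr (_ * _).
by rewrite -mulgA comm mulgA; congr (_ * _); rewrite -!invgM -!expgnDr addnC.
Qed.

Section Subgroup.
Variables (G : groupType) (H : set G).
Hypothesis sH : subgroup H.

Lemma subgroupV x : H x -> H x^-1.
Proof. by move=> Hx; rewrite -div1g; apply: sH.2 => //; exact: sH.1. Qed.

Lemma subgroupM x y : H x -> H y -> H (x * y).
Proof. by move=> Hx /subgroupV Hy; rewrite -[y]invgK; exact: sH.2. Qed.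

Lemma subgroupX x n : H x -> H (x ^+ n).
Proof.
move=> Hx; elim: n => [|n IH]; first by rewrite expg0; exact: sH.1.
by rewrite expgS; exact: subgroupM.
Qed.

End Subgroup.

Lemma generated_gen (G : groupType) (S : set G) x : S x -> generated S x.
Proof. by move=> Sx H [_]; apply. Qed.

Section Extension.
Variables (G T : groupType) (p : {multiplicative G -> T}) (t : G).

Definition same_coset x y : Prop := generated [set p t] (p (x / y)).

Lemma same_cosetP x y : same_coset x y ->
  exists a m n, p a = 1 /\ x = a * t ^- m * t ^+ n * y.
Proof.
move=> /generated1P[m [n pxy]]; exists (x / (t ^- m * t ^+ n * y)), m, n; split.
  by rewrite invgM mulgA morphF pxy gmulfM morphV !morphX mulgV.
by rewrite -!mulgA mulVg mulg1.
Qed.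

(** The coset of 1 is represented by 1, so that the rewriting of a kernel element starts and ends
    without a correcting factor. *)
Record coset_transversal (I : finType) (u : I -> G) (idx : G -> I) : Prop := CosetTransversal {
  transversal_coset : forall g, same_coset g (u (idx g));
  transversal_eq : forall g h, same_coset g h -> idx g = idx h;
  transversalK : cancel u idx;
  transversal1 : u (idx 1) = 1 }.

(** In both cases powers of [t] with equal images are equal; [t = 1] serves for finite [T]. *)
Definition infinite_or_trivial : Prop :=
  (forall m n, p (t ^+ m) = p (t ^+ n) -> m = n) \/ t = 1.

(** Words have nonnegative exponents only; the conjugation by [t ^+ D] supplies the negative
    ones. *)
Definition kernel_generators (J : finType) (a : J -> G) : Prop :=
  (forall j, p (a j) = 1) /\
  forall x, p x = 1 -> exists D W, x = mword_eval t a W ^ (t ^+ D).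

Lemma mword_eval_kernel (J : finType) (a : J -> G) W :
  (forall j, p (a j) = 1) -> p (mword_eval t a W) = 1.
Proof.
move=> pa; rewrite /mword_eval morph_prod big1 // => -[[b e] j] _.
by rewrite /mletter_eval morphJ /=; case: b; rewrite ?morphV pa ?invg1 conj1g.
Qed.

Section Transversal.
Variables (I : finType) (u : I -> G) (idx : G -> I).
Hypothesis tr : coset_transversal u idx.
Hypothesis tP : infinite_or_trivial.

Lemma expg_kernel m n : p (t ^+ m) = p (t ^+ n) -> t ^+ m = t ^+ n.
Proof. by case: tP => [inj /inj ->//|->]; rewrite !expg1n. Qed.

(** Applying [p] erases [x] and the word, so [u i] represents the coset of 1 and is 1; then the
    powers of [p t] are compared. *)
Lemma kernel_word (J : finType) (a : J -> G) x b b' W i :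
  (forall j, p (a j) = 1) -> p x = 1 ->
  t ^+ b * x = mword_eval t a W * t ^+ b' * u i ->
  [/\ u i = 1, t ^+ b = t ^+ b' & mword_eval t a W = x ^ t ^- b].
Proof.
move=> pa px E; have pW := mword_eval_kernel W pa.
have pE : p t ^+ b = p t ^+ b' * p (u i).
  by have := congr1 p E; rewrite !gmulfM pW px mulg1 mul1g !morphX.
have ui : u i = 1.
  rewrite -(transversalK tr i) -[RHS](transversal1 tr); congr u.
  apply: (transversal_eq tr); rewrite /same_coset divg1.
  have -> : p (u i) = p t ^- b' * p t ^+ b by rewrite pE mulKg.
  have sg := @generated_subgroup T [set p t].
  have gt : generated [set p t] (p t) by exact: generated_gen.
  by apply: (subgroupM sg); first apply: (subgroupV sg); exact: (subgroupX sg).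
have tbb' : t ^+ b = t ^+ b'.
  by apply: expg_kernel; rewrite !morphX pE ui morph1 mulg1.
split=> //; rewrite conjgE invgK mulgA E ui mulg1 -tbb'.
by rewrite mulgK.
Qed.

Lemma transversal_step g : exists a m n, p a = 1 /\
  g = t ^- m * a ^ t ^- m * t ^+ n * u (idx g).
Proof.
have [a [m [n [pa gE]]]] := same_cosetP (transversal_coset tr g).
by exists a, m, n; split=> //; rewrite {1}gE conjgE invgK !mulgA mulVg mul1g.
Qed.

(** Schreier's argument: the kernel parts of the products [u i * y v] generate, as the rewriting
    without relators of a word for [x] shows. *)
Lemma kernel_generators_exist (Y : finType) (y : Y -> G) :
  (forall g, exists w, g = \prod_(v <- w) y v) ->
  exists (J : finType) (a : J -> G), kernel_generators a.
Proof.
move=> y_gen.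
have /choice[a aP] : forall iv : I * Y, exists a, exists m n, p a = 1 /\
    u iv.1 * y iv.2 = t ^- m * a ^ t ^- m * t ^+ n * u (idx (u iv.1 * y iv.2)).
  by move=> iv; exact: transversal_step.
exists (I * Y)%type, a; split=> [iv|x px]; first by have [m [n []]] := aP iv.
have step i v : exists (D : nat) (W : seq (mletter (I * Y)%type)) (d l : nat),
    eqa set0 l (u i * y v) (t ^- D * mword_eval t a W * t ^+ d * u (idx (u i * y v))).
  have [m [n [_ E]]] := aP (i, v); exists m, [:: (false, m, (i, v))], n, 0%N.
  by apply: eqa_eq; rewrite {1}E /mword_eval big_seq1.
have [D [c rwP]] := rewrite_word step.
have [w xE] := y_gen x.
have [W [b' [_ _ /eqa_set0]]] := rwP w (idx 1) _ (leqnn _).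
rewrite (transversal1 tr) mulg1 -xE => E.
have pa iv : p (a iv) = 1 by have [m [n []]] := aP iv.
have [_ _ WE] := kernel_word pa px E.
by exists (D * size w)%N, W; rewrite WE conjgKV.
Qed.

End Transversal.
End Extension.

Definition letter_eval (X : Type) (E : groupType) (gen : X -> E) (v : letter X) : E :=
  if v.2 then (gen v.1)^-1 else gen v.1.

Lemma morph_lift (E G : groupType) (phi : {multiplicative E -> G}) :
  range phi = [set: G] -> forall g, exists e, phi e = g.
Proof. move=> rphi g; have [e _ <-] : range phi g by rewrite rphi.
by exists e. Qed.

Lemma presentation_kernel (E G : groupType) (R : set E) (phi : {multiplicative E -> G}) :
  finite_presentation R phi -> forall e, phi e = 1 <-> normal_closure R e.
Proof. by case=> _ _ kerE e; rewrite -kerE. Qed.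

Lemma area_le_closure (E : groupType) (R : set E) l x :
  area_le R l x -> normal_closure R x.
Proof.
move=> [m _ /relator_product_seq[s [_ sR ->]]] N [nN RN].
elim: s sR => [|q s IH] sR; first by rewrite big_nil; exact: nN.1.1.
rewrite big_cons; apply: (subgroupM nN.1); last first.
  by apply: IH => r sr; apply: sR; rewrite inE sr orbT.
apply: nN.2; have [/RN //|[z /RN Nz <-]] := sR q (mem_head _ _).
exact: (subgroupV nN.1).
Qed.

(** * Area bounds from the cost of commutation *)

Section AreaBound.
Variables (G T : groupType) (p : {multiplicative G -> T}) (t : G).
Variables (I : finType) (u : I -> G) (idx : G -> I) (J : finType) (a : J -> G).
Hypotheses (tr : coset_transversal p t u idx) (tP : infinite_or_trivial p t).
Hypothesis aP : kernel_generators p t a.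

(* The degree [d] is chosen before the presentation, since the theorem asks for
   one degree valid for all relative presentations. *)
Lemma area_bound : exists d : nat, forall (E : groupType) (X : finType)
    (gen : X -> E) (R : set E) (phi : {multiplicative E -> G}),
  finite_presentation R phi ->
  exists (s : E) (b : J -> E) (C : nat),
    [/\ phi s = t, forall j, phi (b j) = a j
      & forall l n (w : word X),
          (forall x y, (x.1.2 < C * n.+1)%N -> (y.1.2 < C * n.+1)%N ->
             commute_a R l (mletter_eval s b x) (mletter_eval s b y)) ->
          (size w <= n)%N -> phi (word_eval gen w) = 1 ->
          (area R (word_eval gen w) <= C * n.+2 ^ d * l.+1)%N].
Proof.
have [d mwordA] := mword_area t a.
exists d.+1 => E X gen R phi presR.
have kerR := presentation_kernel presR.
have lift := morph_lift (let: And3 _ r _ := presR in r).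
(* The lift of [t] is 1 when [t] is, so that the equality of powers of [t] found by [kernel_word]
   lifts to an equality of powers of [s]. *)
have [s [phis s1]] : exists s, phi s = t /\ (t = 1 -> s = 1).
  have [->|/eqP t1] := eqVneq t 1; first by exists 1; rewrite morph1.
  by have [s sE] := lift t; exists s; split.
have /choice[b bE] : forall j, exists e, phi e = a j by move=> j; exact: lift.
(* A representative equal to 1 is lifted to 1; the trailing factor then disappears without cost. *)
have /choice[u' u'P] : forall i, exists e, phi e = u i /\ (u i = 1 -> e = 1).
  move=> i; have [->|/eqP ui] := eqVneq (u i) 1; first by exists 1; rewrite morph1.
  by have [e eE] := lift (u i); exists e; split.
have evE W : phi (mword_eval s b W) = mword_eval t a W.
  rewrite mword_eval_morph phis; congr mword_eval; exact/funext.
have step i (v : letter X) : exists (D : nat) (W : seq (mletter J)) (e l : nat),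
    eqa R l (u' i * letter_eval gen v)
      (s ^- D * mword_eval s b W * s ^+ e * u' (idx (u i * phi (letter_eval gen v)))).
  have [a' [m [n [pa' gE]]]] :=
    same_cosetP (transversal_coset tr (u i * phi (letter_eval gen v))).
  have [D [W a'E]] := aP.2 a' pa'; move: gE; set i' := idx _ => gE.
  exists (D + m)%N, (shift m W), (D + n)%N; apply: eqa_exists; apply/kerR.
  apply/eqP; rewrite morphF mulg_eq1 invgK; apply/eqP.
  rewrite !gmulfM morphV !morphX evE phis (u'P i).1 (u'P i').1 gE; congr (_ * _).
  rewrite a'E conjgE !mulgA mword_eval_shift conjgE (addnC D m) !expgnDr !invgM.
  rewrite invgK !mulgA mulgVK; congr (_ * _); rewrite -!mulgA; congr (_ * (_ * _)).
  exact/commuteV/commuteX2.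
have [D [c rwP]] := @rewrite_word J (X * bool)%type I E R s b (letter_eval gen) u'
  (fun i v => idx (u i * phi (letter_eval gen v))) step.
have [C CP] := mwordA E R phi s b (fun e => iffLR (kerR e)) phis bE.
(* One constant serves twice: the terms [D + c + C] bound the exponents, the rest is the factor in
   the final area bound. *)
exists s, b, (D + c + C + (c + C * (D + 2 * c + 2) ^ d))%N; split=> // l n w comm le_wn pw1.
have [W [b' [sW bW]]] := rwP w (idx 1) _ (leqnn _).
set B := (D * size w)%N in bW *; set i' := foldl _ _ _.
rewrite (u'P (idx 1)).2 ?(transversal1 tr) // mulg1 => rwW.
pose x := word_eval gen w; have xE : \prod_(v <- w) letter_eval gen v = x by [].
rewrite xE in rwW.
have E' : t ^+ B * phi x = mword_eval t a W * t ^+ b' * u i'.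
  have /kerR := area_le_closure rwW; rewrite morphF => /divg1_eq.
  by rewrite !gmulfM !morphX evE phis (u'P i').1.
have [ui' tbb' W1] := kernel_word tr tP aP.1 (etrans (congr1 p pw1) (morph1 p)) E'.
have sbb' : s ^+ B = s ^+ b'.
  case: (tP) => [inj|/s1 ->]; last by rewrite !expg1n.
  by congr (s ^+ _); apply: inj; rewrite tbb'.
have {}W1 : mword_eval t a W = 1 by rewrite W1 pw1 conj1g.
set M := ((D + c) * n.+1)%N; set N := (c * n)%N.
have le_cn : (c * size w <= N)%N by rewrite leq_mul2l le_wn orbT.
have bWM : below M W.
  refine (belowW _ bW); rewrite /B /M mulnDl leq_add // leq_mul2l; apply/orP; right.
    exact: leqW.
  by rewrite ltnS.
have areaW : area_le R (C * (M + N + 2) ^ d * l.+1) (mword_eval s b W).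
  apply: CP W1 => //; last exact: leq_trans sW le_cn.
  have leM : (M + C <= (D + c + C + (c + C * (D + 2 * c + 2) ^ d)) * n.+1)%N.
    rewrite !mulnDl -/M; nia.
  by move=> y z yM zM; apply: comm; exact: leq_trans leM.
have := area_leM rwW areaW; rewrite (u'P i').2 // mulg1 -sbb' invgM !mulgA => areax.
have {}areax : area_le R (c * size w + C * (M + N + 2) ^ d * l.+1) x.
  rewrite mulgVK in areax.
  by have := area_leJ (s ^+ B) areax; rewrite conjgE !mulgA mulVg mul1g mulgVK.
apply: area_leP; first by apply/kerR.
apply: area_leW areax; set Q := (D + 2 * c + 2)%N; set n2 := n.+2.
have leQ : (M + N + 2 <= Q * n2)%N by rewrite /M /N /Q /n2; nia.
have {}leQ : ((M + N + 2) ^ d <= Q ^ d * n2 ^ d)%N.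
  by rewrite -expnMn; case: (d) => // k; rewrite leq_exp2r.
have n2_gt0 : (0 < n2 ^ d)%N by rewrite expn_gt0.
rewrite expnS; set U := (n2 ^ d)%N in leQ n2_gt0 *; set V := (Q ^ d)%N in leQ *.
have le1 : (c * size w <= c * (n2 * U) * l.+1)%N.
  apply: leq_trans le_cn _; rewrite /N -mulnA leq_mul2l; apply/orP; right.
  by rewrite -mulnA; apply: (@leq_trans n2); rewrite ?leq_pmulr // ?muln_gt0 ?n2_gt0 // /n2; lia.
have le2 : (C * (M + N + 2) ^ d * l.+1 <= C * V * (n2 * U) * l.+1)%N.
  rewrite leq_mul2r; apply/orP; right; rewrite -mulnA leq_mul2l; apply/orP; right.
  by apply: leq_trans leQ _; rewrite leq_mul2l; apply/orP; right; rewrite leq_pmull.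
apply: leq_trans (leq_add le1 le2) _; rewrite -!mulnDl.
by rewrite leq_mul2r; apply/orP; right; rewrite leq_mul2r; apply/orP; right; rewrite leq_addl.
Qed.

End AreaBound.

(** * Relative Dehn functions *)

Lemma commgMr (E : groupType) (x y z : E) : [~ x, y * z] = [~ x, z] * [~ x, y] ^ z.
Proof. by rewrite !commgEl (conjgM x) (conjMg x^-1) conjVg -mulgA mulVKg. Qed.

Lemma mulg_commg (E : groupType) (x y : E) : x ^ y = x * [~ x, y].
Proof. by rewrite commgEl mulVKg. Qed.

(* Commutators commute exactly, so a conjugation by [s] changes [b i] only by
   a factor which does not affect its commutation with commutators. *)
Lemma commute_conj_exp (E : groupType) (R : set E) (J : finType) (s : E) (b : J -> E) k :
  (forall x y z w : E, commute [~ x, y] [~ z, w]) ->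
  (forall i j, commute_a R k (b i) (b j)) ->
  (forall i j, commute_a R k (b i) [~ b j, s]) ->
  forall c i j, commute_a R (k + c * k) (b i) (b j ^ s ^+ c).
Proof.
move=> metaE bb bbs c i j; rewrite mulg_commg; apply: commute_aM => //.
elim: c => [|c IH]; first by rewrite expg0 commg1; exact: commute_a1.
rewrite expgSr commgMr mulSn; apply: commute_aM => //.
rewrite -(conjgKV s (b i)); apply: commute_aJ; apply: commute_a_sym.
rewrite mulg_commg -[(c * k)%N]addn0; apply: commute_aM; first exact: commute_a_sym.
exact: eqa_eq (metaE _ _ _ _).
Qed.

(** Conjugation by a power of [s] brings the larger exponent to 0, so only the difference of
    exponents matters. *)
Lemma commute_a_mletters (E : groupType) (R : set E) (J : finType) (s : E) (b : J -> E) l M :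
  (forall c i j, (c < M)%N -> commute_a R l (b i) (b j ^ s ^+ c)) ->
  forall x y, (x.1.2 < M)%N -> (y.1.2 < M)%N ->
    commute_a R l (mletter_eval s b x) (mletter_eval s b y).
Proof.
move=> comm x y; wlog le_xy : x y / (x.1.2 <= y.1.2)%N => [H xM yM|xM yM].
  case: (leqP x.1.2 y.1.2) => [|/ltnW] le; first exact: H.
  by apply: commute_a_sym; exact: H.
have sign (c : bool) z w : commute_a R l z w -> commute_a R l z (if c then w^-1 else w).
  by case: c => // ?; exact: commute_aV.
have := comm (y.1.2 - x.1.2)%N y.2 x.2 _ => /(_ (ltac:(lia))).
move=> /(sign x.1.1) /commute_a_sym /(sign y.1.1) /(commute_aJ (s ^- y.1.2)).
rewrite /mletter_eval.
have -> : (if x.1.1 then (b x.2 ^ s ^+ (y.1.2 - x.1.2))^-1 else b x.2 ^ s ^+ (y.1.2 - x.1.2))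
    = (if x.1.1 then (b x.2)^-1 else b x.2) ^ s ^+ (y.1.2 - x.1.2).
  by case: ifP => //; rewrite conjVg.
rewrite -conjgM.
have -> // : s ^+ (y.1.2 - x.1.2) / s ^+ y.1.2 = s ^- x.1.2.
by rewrite -{2}(subnKC le_xy) expgnDr invgM mulVKg.
Qed.

Lemma free_metabelian_commute (X : choiceType) (x y z w : free_metabelian X) :
  commute [~ x, y] [~ z, w].
Proof.
pose pi := coset_pi (derived2_normal (free_group X)).
have piM u v : pi u * pi v = pi (u * v) by exact: coset_piM.
have piV u : (pi u)^-1 = pi u^-1 by exact: coset_piV.
have piR u v : [~ pi u, pi v] = pi [~ u, v].
  by rewrite !commgEl !conjgE !piV (piM u v) (piM v^-1) (piM u^-1).
have reprK u : u = pi (repr u) by exact/esym/coset_reprK.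
rewrite (reprK x) (reprK y) (reprK z) (reprK w) !piR /commute.
move: (repr x) (repr y) (repr z) (repr w) => x' y' z' w'.
rewrite (piM [~ x', y']) (piM [~ z', w']); apply/coset_piP.
have -> : [~ x', y'] * [~ z', w'] / ([~ z', w'] * [~ x', y']) =
    [~ [~ x', y']^-1, [~ z', w']^-1].
  by rewrite [RHS]commgEl conjgE !invgK invgM !mulgA.
have derivedR (u v : free_group X) : derived [set: free_group X] [~ u, v]^-1.
  by rewrite invgR; apply: generated_gen; exists v => //; exists u.
by apply: generated_gen; exists [~ x', y']^-1 => //; exists [~ z', w']^-1.
Qed.

Lemma dehn_function_le (X : finType) (E G : groupType) (gen : X -> E) (R : set E)
    (phi : {multiplicative E -> G}) (n B : nat) :
  (forall w : word X, (size w <= n)%N -> phi (word_eval gen w) = 1 ->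
     (area R (word_eval gen w) <= B)%N) -> (dehn_function gen R phi n <= B)%N.
Proof.
move=> areaB; apply/bigmax_leqP => k _; apply/bigmax_leqP => w /eqP pw1.
by apply: areaB => //; rewrite size_tuple -ltnS.
Qed.

Section Relative.
Variables (G T : groupType) (p : {multiplicative G -> T}) (t : G).
Variables (I : finType) (u : I -> G) (idx : G -> I) (J : finType) (a : J -> G).
Hypotheses (tr : coset_transversal p t u idx) (tP : infinite_or_trivial p t).
Hypothesis aP : kernel_generators p t a.
Hypothesis abK : forall x y, p x = 1 -> p y = 1 -> commute x y.

(** In a free metabelian group the cost of commuting letters is linear in their exponents, hence in
    [n]; this raises the degree by one. *)
Lemma relative_dehn_bound : exists d : nat,
  forall (X : finType) (R : set (free_metabelian X))
    (phi : {multiplicative free_metabelian X -> G}),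
  finite_presentation R phi ->
  dehn_le (dehn_function (@fm_gen X) R phi) (fun n => (n ^ d)%N).
Proof.
have [d area_d] := area_bound tr tP aP; exists d.+1 => X R phi presR.
have [s [b [C [phis phib areaC]]]] := area_d _ X (@fm_gen X) R phi presR.
have kerR := presentation_kernel presR.
(* The images of [b j] and of [[~ b j, s]] lie in the kernel of [p], which is commutative. *)
have [k kP] : exists k, forall ij : J * J,
    commute_a R k (b ij.1) (b ij.2) /\ commute_a R k (b ij.1) [~ b ij.2, s].
  apply: uniform_bound => [ij m n le_mn [c1 c2]|[i j]].
    by split; apply: commute_aW le_mn _.
  have comm x : p (phi x) = 1 -> exists k, commute_a R k (b i) x.
    move=> px; apply: eqa_exists; apply/kerR; apply/eqP.
    rewrite morphF mulg_eq1 invgK !gmulfM phib; apply/eqP; apply: abK => //.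
    exact: aP.1.
  have [|k1 c1] := comm (b j); first by rewrite phib aP.1.
  have [|k2 c2] := comm [~ b j, s]; first by rewrite !morphR phib aP.1 comm1g.
  exists (k1 + k2)%N; split; [apply: commute_aW c1|apply: commute_aW c2]; lia.
have bound n : (dehn_function (@fm_gen X) R phi n <= C * (C * k + k + 1) * n.+2 ^ d.+1)%N.
  apply: dehn_function_le => w le_wn pw1.
  pose l := (k + C * n.+1 * k)%N.
  apply: leq_trans (areaC l n w _ le_wn pw1) _.
    apply: commute_a_mletters => c i j le_c.
    apply: (@commute_aW _ _ (k + c * k)%N); first by rewrite /l leq_add2l leq_mul2r ltnW ?orbT.
    apply: commute_conj_exp => [|i' j'|i' j']; first exact: free_metabelian_commute.
      exact: (kP (i', j')).1.
    exact: (kP (i', j')).2.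
  rewrite expnS -!mulnA leq_mul2l; apply/orP; right.
  rewrite mulnC [leqRHS]mulnA leq_mul2r; apply/orP; right.
  rewrite /l; nia.
exists (C * (C * k + k + 1) * 3 ^ d.+1).+1 => // n.
apply: leq_trans (bound n) _; set K := (C * _)%N.
(* At [n = 0] the power on the right vanishes and the additive constant is used; otherwise [n.+2] is
   at most [3 * n]. *)
case: n => [|n].
  have H : (2 ^ d.+1 <= 3 ^ d.+1)%N by rewrite leq_exp2r.
  by apply: leq_trans (leq_mul (leqnn K) H) _; lia.
apply: (@leq_trans (K * 3 ^ d.+1 * n.+1 ^ d.+1)).
  by rewrite -mulnA leq_mul2l -expnMn leq_exp2r //; apply/orP; right; lia.
set C' := (K * _).+1.
apply: (@leq_trans (C' * (C' * n.+1) ^ d.+1)); last by rewrite -addnA leq_addr.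
by apply: leq_mul; rewrite ?leqnSn // leq_exp2r // leq_pmull.
Qed.

End Relative.

(** * Transversals over virtually cyclic quotients *)

Lemma finite_transversal (G : choiceType) (g0 : G) (rel : G -> G -> Prop) (l : seq G) :
  (forall x, rel x x) -> (forall x y, rel x y -> rel y x) ->
  (forall x y z, rel x y -> rel y z -> rel x z) ->
  (forall x, exists2 y, y \in l & rel x y) ->
  exists (I : finType) (u : I -> G) (idx : G -> I),
    [/\ forall g, rel g (u (idx g)), forall g h, rel g h -> idx g = idx h,
        cancel u idx & u (idx g0) = g0].
Proof.
move=> rel_refl rel_sym rel_trans l_cov.
(* The value depends only on the class of [g], and the class of [g0] receives [g0]. The default of
   [head] is never reached, as the list meets every class. *)
pose rep g := if `[< rel g g0 >] then g0 else head g0 [seq h <- l | `[< rel g h >]].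
have rep_rel g : rel g (rep g).
  rewrite /rep; case: asboolP => // _; have [y ly gy] := l_cov g.
  have : y \in [seq h <- l | `[< rel g h >]] by rewrite mem_filter ly andbT; apply/asboolP.
  case E : [seq h <- l | `[< rel g h >]] => [//|z s] _ /=.
  have : z \in [seq h <- l | `[< rel g h >]] by rewrite E mem_head.
  by rewrite mem_filter => /andP[/asboolP].
have rep_eq g h : rel g h -> rep g = rep h.
  move=> gh; have E z : `[< rel g z >] = `[< rel h z >].
    by apply: asbool_equiv_eq; split=> H; apply: rel_trans H => //; exact: rel_sym.
  by rewrite /rep E; case: ifP => // _; congr head; apply: eq_filter => z; rewrite E.
have rep_rep g : rep (rep g) = rep g by apply: rep_eq; exact: rel_sym.
have rep_in g : rep g \in map rep (g0 :: l).
  rewrite -rep_rep; apply: map_f; rewrite /rep; case: ifP => _; first exact: mem_head.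
  rewrite inE; case E : [seq h <- l | `[< rel g h >]] => [|z s] /=; first by rewrite eqxx.
  have : z \in [seq h <- l | `[< rel g h >]] by rewrite E mem_head.
  by rewrite mem_filter => /andP[_ ->]; rewrite orbT.
exists (seq_sub (map rep (g0 :: l))), (@ssval _ _), (fun g => SeqSub (rep_in g)); split => //=.
- by move=> g h /rep_eq gh; apply: val_inj.
- move=> [x xs]; apply: val_inj => /=.
  have [h _ xE] : exists2 h, h \in g0 :: l & x = rep h by apply/mapP.
  by rewrite xE rep_rep.
by rewrite /rep; case: asboolP => // /(_ (rel_refl _)).
Qed.

Lemma coset_transversal_exist (G T : groupType) (p : {multiplicative G -> T}) (t : G)
    (l : seq T) : range p = [set: T] ->
  (forall x, exists2 y, y \in l & generated [set p t] (x / y)) ->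
  exists (I : finType) (u : I -> G) (idx : G -> I), coset_transversal p t u idx.
Proof.
move=> surj l_cov; have sg := @generated_subgroup T [set p t].
have /choice[q qP] := morph_lift surj.
have [||||I [u [idx [H1 H2 H3 H4]]]] := @finite_transversal G 1 (same_coset p t) (map q l).
- by move=> x; rewrite /same_coset divgg morph1; exact: sg.1.
- by move=> x y /(subgroupV sg); rewrite -morphV invgF.
- move=> x y z xy yz; rewrite /same_coset -(divgKA y) gmulfM; exact: (subgroupM sg).
- move=> x; have [y ly xy] := l_cov (p x); exists (q y); first exact: map_f.
  by rewrite /same_coset morphF qP.
by exists I, u, idx.
Qed.

Lemma finite_index_seq (T : groupType) (H : set T) : subgroup H -> finite_index H ->
  exists l : seq T, forall x, exists2 y, y \in l & H (x / y).
Proof.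
move=> sH /finite_seqP[s sE]; exists (map (xget 1) s) => x.
pose Hx := [set h * x | h in H].
have Hxs : Hx \in s by have : [set` s] Hx by rewrite -sE; exists x.
have : Hx (xget 1 Hx) by apply: (@xgetPex _ _ Hx); exists (1 * x); exists 1 => //; exact: sH.1.
move=> [h Hh hxE]; exists (xget 1 Hx); first exact: map_f.
by rewrite -hxE invgM mulVKg; exact: (subgroupV sH).
Qed.

(** If [t0] has infinite order, a lift of it is taken. Otherwise [T] is finite, [t] is 1 and the
    cosets correspond to the elements of [T]. *)
Lemma virtually_cyclic_transversal (G T : groupType) (p : {multiplicative G -> T}) :
  range p = [set: T] -> virtually_cyclic T ->
  exists (t : G) (I : finType) (u : I -> G) (idx : G -> I),
    infinite_or_trivial p t /\ coset_transversal p t u idx.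
Proof.
move=> surj [t0 fin_t0].
have [l l_cov] := finite_index_seq (@generated_subgroup T _) fin_t0.
have [inj|ninj] := pselect (forall m n, t0 ^+ m = t0 ^+ n -> m = n).
  have [t tE] := morph_lift surj t0.
  have [|I [u [idx tr]]] := @coset_transversal_exist G T p t l surj.
    by move=> x; rewrite tE.
  by exists t, I, u, idx; split=> //; left=> m n; rewrite !morphX tE; exact: inj.
have [k k_gt0 t0k] : exists2 k, (0 < k)%N & t0 ^+ k = 1.
  have [m [n [lt_mn E]]] : exists m n, (m < n)%N /\ t0 ^+ m = t0 ^+ n.
    apply: contrapT => H; apply: ninj => m n E.
    by case: (ltngtP m n) => // lt; case: H; [exists m, n|exists n, m].
  exists (n - m)%N; first by rewrite subn_gt0.
  by rewrite expgnFr ?mulgV // -?E ?mulgV // ltnW.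
pose l' := [seq t0 ^+ j * y | j <- iota 0 k, y <- l].
have [|I [u [idx tr]]] := @coset_transversal_exist G T p 1 l' surj.
  move=> x; have [y ly /generated1P[m [n xy]]] := l_cov x.
  (* Since [t0 ^+ k = 1], the power [t0 ^+ (m * k.-1)] equals [t0 ^- m]. *)
  pose j := ((m * k.-1 + n) %% k)%N.
  have xE : x = t0 ^+ j * y.
    have kX i : t0 ^+ (k * i) = 1 by rewrite expgnA t0k expg1n.
    have -> : t0 ^+ j = x / y.
      rewrite xy; have -> : t0 ^- m = t0 ^+ (m * k.-1).
        apply: mulg1_eq; rewrite -expgnDr.
        by have -> : (m + m * k.-1 = k * m)%N by rewrite -mulnS prednK // mulnC.
      rewrite -expgnDr [in RHS](divn_eq (m * k.-1 + n) k) mulnC expgnDr kX mul1g //.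
    by rewrite mulgVK.
  exists x; last by rewrite divgg; exact: (@generated_subgroup T _).1.
  by rewrite xE; apply: allpairs_f => //; rewrite mem_iota add0n ltn_pmod.
by exists 1, I, u, idx; split=> //; right.
Qed.

Lemma finitely_generated_word (G : groupType) : finitely_generated G ->
  exists (Y : finType) (y : Y -> G), forall g, exists w, g = \prod_(v <- w) y v.
Proof.
move=> [S /finite_seqP[s ->] genS].
exists (seq_sub s * bool)%type, (fun v => if v.2 then (val v.1)^-1 else val v.1) => g.
pose y (v : seq_sub s * bool) := if v.2 then (val v.1)^-1 else val v.1.
have : generated [set` s] g by rewrite genS.
move=> /(_ [set g | exists w, g = \prod_(v <- w) y v]); apply; split=> [|x /= sx]; last first.
  by exists [:: (SeqSub sx, false)]; rewrite big_seq1.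
split=> [|x1 x2 [w1 ->] [w2 ->]]; first by exists [::]; rewrite big_nil.
exists (w1 ++ rev (map (fun v => (v.1, ~~ v.2)) w2)); rewrite big_cat; congr (_ * _).
rewrite -map_rev big_map -{1}[w2]revK -prodgV; apply: eq_bigr => -[v []] _ //=.
by rewrite invgK.
Qed.

(** * Ascending generators in finitely presented groups *)

(** The inverse is kept as data for the group structure; equality is still decided by the function
    alone. *)
Record selfbij (S : Type) := SelfBij {
  selfbij_fun :> S -> S; selfbij_inv : S -> S;
  selfbijK : cancel selfbij_fun selfbij_inv; selfbijVK : cancel selfbij_inv selfbij_fun }.

Section BijGroup.
Variable S : Type.

HB.instance Definition _ := gen_eqMixin (selfbij S).
HB.instance Definition _ := gen_choiceMixin (selfbij S).

Lemma selfbij_eq (f g : selfbij S) : f =1 g -> f = g.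
Proof.
case: f g => [f f' fK f'K] [g g' gK g'K] /= /funext fg; move: fK f'K; rewrite {}fg => fK f'K.
have E : f' = g' by apply: funext => x; rewrite -{1}(g'K x) fK.
by move: fK f'K; rewrite E => fK f'K; congr SelfBij; exact: Prop_irrelevance.
Qed.

Definition selfbij_one : selfbij S := @SelfBij S id id (fun=> erefl) (fun=> erefl).
(* Bijections act on the right: [f * g] applies [f] first. *)
Definition selfbij_mul (f g : selfbij S) : selfbij S :=
  @SelfBij S (fun x => g (f x)) (fun x => selfbij_inv f (selfbij_inv g x))
    (can_comp (@selfbijK _ g) (@selfbijK _ f)) (can_comp (@selfbijVK _ f) (@selfbijVK _ g)).
Definition selfbij_opp (f : selfbij S) : selfbij S := SelfBij (@selfbijVK _ f) (@selfbijK _ f).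

Lemma selfbij_mulA : associative selfbij_mul. Proof. by move=> f g h; exact: selfbij_eq. Qed.
Lemma selfbij_mul1 : left_id selfbij_one selfbij_mul. Proof. by move=> f; exact: selfbij_eq. Qed.
Lemma selfbij_mulr1 : right_id selfbij_one selfbij_mul. Proof. by move=> f; exact: selfbij_eq. Qed.
Lemma selfbij_mulV : left_inverse selfbij_one selfbij_opp selfbij_mul.
Proof. by move=> f; apply: selfbij_eq => x /=; exact: selfbijVK. Qed.
Lemma selfbij_mulrV : right_inverse selfbij_one selfbij_opp selfbij_mul.
Proof. by move=> f; apply: selfbij_eq => x /=; exact: selfbijK. Qed.

HB.instance Definition _ :=
  isGroup.Build (selfbij S) selfbij_mulA selfbij_mul1 selfbij_mulr1 selfbij_mulV selfbij_mulrV.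

Lemma selfbijM (f g : selfbij S) x : (f * g) x = g (f x). Proof. by []. Qed.
Lemma selfbijV (f : selfbij S) x : f^-1 x = selfbij_inv f x. Proof. by []. Qed.

End BijGroup.

(** * Words and morphisms from free groups *)

Section Words.
Variables (X : Type) (E : groupType) (gen : X -> E).

Lemma word_eval_cat w1 w2 : word_eval gen (w1 ++ w2) = word_eval gen w1 * word_eval gen w2.
Proof. by rewrite /word_eval big_cat. Qed.

Lemma word_eval_cons v w : word_eval gen (v :: w) = letter_eval gen v * word_eval gen w.
Proof. by rewrite /word_eval big_cons. Qed.

Lemma word_eval_nil : word_eval gen [::] = 1.
Proof. by rewrite /word_eval big_nil. Qed.

Lemma word_eval_seq1 v : word_eval gen [:: v] = letter_eval gen v.
Proof. by rewrite /word_eval big_seq1. Qed.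

Lemma word_eval_morph (G : groupType) (f : {multiplicative E -> G}) w :
  f (word_eval gen w) = word_eval (fun x => f (gen x)) w.
Proof.
by rewrite /word_eval morph_prod; apply: eq_bigr => -[x []] _ //=; rewrite morphV.
Qed.

Lemma letter_eval_neg v : letter_eval gen (v.1, ~~ v.2) = (letter_eval gen v)^-1.
Proof. by case: v => x []; rewrite /letter_eval //= invgK. Qed.

Lemma words_subgroup : subgroup [set g | exists w, g = word_eval gen w].
Proof.
split; first by exists [::]; rewrite word_eval_nil.
move=> _ _ [w1 ->] [w2 ->]; exists (w1 ++ rev [seq (v.1, ~~ v.2) | v <- w2]).
rewrite word_eval_cat; congr (_ * _); rewrite /word_eval -map_rev big_map.
rewrite -{1}[w2]revK -prodgV; apply: eq_bigr => v _.
exact/esym/(letter_eval_neg v).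
Qed.

End Words.

Section FreeGroupMorphism.
Variables (X : choiceType) (E : groupType) (gen : X -> E).

Definition free_group_morphism (e : free_group X) : E := word_eval gen (fg_word e).

Lemma word_eval_foldr_push u v :
  word_eval gen (foldr (@push X) v u) = word_eval gen u * word_eval gen v.
Proof.
elim: u => [|c u IH] /=; first by rewrite word_eval_nil mul1g.
rewrite word_eval_cons -mulgA -IH; case: (foldr _ _ _) => [|d w] /=.
  by rewrite word_eval_seq1 word_eval_nil mulg1.
case: eqP => [->|_]; last by rewrite word_eval_cons.
by rewrite word_eval_cons letter_eval_neg mulVKg.
Qed.

Lemma free_group_morphismM : {morph free_group_morphism : x y / x * y}.
Proof. by move=> x y; exact: word_eval_foldr_push. Qed.

HB.instance Definition _ :=
  isMultiplicative.Build (free_group X) E free_group_morphism free_group_morphismM.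

Lemma free_group_morphism_word w :
  free_group_morphism (word_eval (@fg_gen X) w) = word_eval gen w.
Proof.
rewrite (word_eval_morph _ free_group_morphism); congr word_eval; apply/funext => x.
exact: (word_eval_seq1 gen (x, false)).
Qed.

End FreeGroupMorphism.

Lemma fg_wordK (X : choiceType) (e : free_group X) : word_eval (@fg_gen X) (fg_word e) = e.
Proof.
suff E w : fg_word (word_eval (@fg_gen X) w) = reduce w.
  by apply: val_inj; rewrite /= E reduce_id // fg_reduced.
elim: w => [|[x c] w IH]; first by rewrite word_eval_nil.
by rewrite word_eval_cons /= -IH; case: c.
Qed.

(** * A permutation that twists the action of [t] *)

Section ThreeCycle.
Variables (G T : groupType) (p : {multiplicative G -> T}) (t : G) (H : set G).
Hypothesis inj_t : forall m n, p (t ^+ m) = p (t ^+ n) -> m = n.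
Hypotheses (sH : subgroup H) (pH : forall h, H h -> p h = 1).

Lemma right_mulK (g : G) : cancel (fun x => x * g) (fun x => x * g^-1).
Proof. by move=> x; rewrite mulgK. Qed.
Lemma right_mulVK (g : G) : cancel (fun x => x * g^-1) (fun x => x * g).
Proof. by move=> x; rewrite mulgVK. Qed.

Definition right_mul (g : G) : selfbij G := SelfBij (right_mulK g) (right_mulVK g).

Lemma right_mulM g h : right_mul (g * h) = right_mul g * right_mul h.
Proof. by apply: selfbij_eq => x; rewrite selfbijM /= mulgA. Qed.

Lemma right_mul1 : right_mul 1 = 1.
Proof. by apply: selfbij_eq => x; rewrite /= mulg1. Qed.

Lemma right_mulV g : right_mul g^-1 = (right_mul g)^-1.
Proof. by apply: selfbij_eq. Qed.

Definition in_translate k (x : G) : bool := `[< H (t ^- k * x) >].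

Lemma in_translate_p k x : in_translate k x -> p x = p (t ^+ k).
Proof.
by move=> /asboolP /pH; rewrite gmulfM morphV => /(canRL (mulKg _)); rewrite mulg1 invgK.
Qed.

(** The translates [t ^+ k * H] lie over distinct powers of [p t], hence are disjoint. *)
Lemma in_translate_inj k l x : in_translate k x -> in_translate l x -> k = l.
Proof. by move=> /in_translate_p xk /in_translate_p xl; apply: inj_t; rewrite -xk. Qed.

Lemma in_translateM k l x : in_translate (k + l) (t ^+ k * x) = in_translate l x.
Proof. by rewrite /in_translate expgnDr invgM -mulgA mulKg. Qed.

Lemma in_translateMr k x h : H h -> in_translate k (x * h) = in_translate k x.
Proof.
move=> Hh; apply: asbool_equiv_eq; rewrite mulgA; split=> [Hxh|Hx].
  by rewrite -(mulgK h (_ * x)); exact: (subgroupM sH) Hxh (subgroupV sH Hh).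
exact: (subgroupM sH).
Qed.

(* The cosets [H], [t^2 H] and [t H] are permuted cyclically. *)
Definition cycle_fun x :=
  if in_translate 0 x then t ^+ 2 * x else
  if in_translate 1 x || in_translate 2 x then t^-1 * x else x.

Definition cycle_inv x :=
  if in_translate 2 x then t ^- 2 * x else
  if in_translate 0 x || in_translate 1 x then t * x else x.

Lemma cycle_funE x : [\/ in_translate 0 x /\ cycle_fun x = t ^+ 2 * x,
  exists2 y, (in_translate 0 y || in_translate 1 y) & x = t * y /\ cycle_fun x = y |
  (forall k, (k < 3)%N -> ~~ in_translate k x) /\ cycle_fun x = x].
Proof.
rewrite /cycle_fun; case: ifP => [x0|x0]; first by constructor 1.
case: ifP => [x12|x12].
  constructor 2; exists (t^-1 * x); last by rewrite mulVKg.
  by rewrite -(in_translateM 1 0) -(in_translateM 1 1) expg1 mulVKg.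
constructor 3; split=> // -[|[|[|//]]] _; rewrite ?x0 //.
  by case/norP: (negbT x12).
by case/norP: (negbT x12).
Qed.

Lemma cycle_funK : cancel cycle_fun cycle_inv.
Proof.
move=> x; case: (cycle_funE x) => [[x0 ->]|[y y01 [-> ->]]|[xk ->]]; rewrite /cycle_inv.
- by rewrite -[in_translate 2 _]/(in_translate (2 + 0) _) in_translateM x0 mulKg.
- by rewrite y01 ifN //; apply/negP => y2; case/orP: y01 => /in_translate_inj/(_ y2).
- by rewrite (negbTE (xk 2%N isT)) (negbTE (xk 0%N isT)) (negbTE (xk 1%N isT)).
Qed.

Lemma cycle_invK : cancel cycle_inv cycle_fun.
Proof.
move=> x; rewrite /cycle_inv; case: ifP => [x2|x2].
  have y0 : in_translate 0 (t ^- 2 * x) by rewrite -(in_translateM 2 0) mulVKg.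
  by rewrite /cycle_fun y0 mulVKg.
case: ifP => [x01|x01].
  have tx12 : in_translate 1 (t * x) || in_translate 2 (t * x).
    by rewrite -[t in t * x]expg1 (in_translateM 1 0) (in_translateM 1 1).
  rewrite /cycle_fun ifN ?tx12 ?mulKg //; apply/negP => tx0.
  by case/orP: tx12 => /in_translate_inj/(_ tx0).
by move/norP: (negbT x01) => [/negbTE x0 /negbTE x1]; rewrite /cycle_fun x0 x1 x2.
Qed.

Definition cycle_bij : selfbij G := SelfBij cycle_funK cycle_invK.

(** Right multiplication by [H] preserves each left coset, and the permutation multiplies each of
    them on the left by a fixed power of [t]. *)
Lemma cycle_right_mul h : H h -> cycle_bij * right_mul h = right_mul h * cycle_bij.
Proof.
move=> Hh; apply: selfbij_eq => x; rewrite !selfbijM /= /cycle_fun !in_translateMr //.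
by case: ifP => _; last case: ifP => _; rewrite ?mulgA.
Qed.

Definition twisted_t : selfbij G := right_mul t * cycle_bij.

(** On [H] the twisted element conjugates as [t] does, so relations that stay within [H] survive the
    twist. *)
Lemma twisted_right_mul h : H h ->
  twisted_t * right_mul h = right_mul (h ^ t^-1) * twisted_t.
Proof.
move=> Hh; rewrite /twisted_t -mulgA cycle_right_mul // !mulgA -!right_mulM.
by rewrite conjgE invgK !mulgA mulgVK.
Qed.

(** Both sides are applied to 1. On the left [x] is fixed by the inverse cycle and the result lies
    over 1 or [p (t ^+ 2)]; on the right the path goes through [t] and [t * y ^ t], and ends over
    [p t]. *)
Lemma twisted_noncommute x y : p x = 1 -> p y = 1 -> ~ H x -> ~ H (y ^ t) ->
  right_mul x * right_mul y ^ twisted_t <> right_mul y ^ twisted_t * right_mul x.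
Proof.
move=> px py Hx Hy.
have -> : right_mul y ^ twisted_t = cycle_bij^-1 * (right_mul (y ^ t) * cycle_bij).
  by rewrite /twisted_t conjgM [in RHS]conjgE !right_mulM right_mulV.
move: Hy; set z := y ^ t => Hz; have pz : p z = 1 by rewrite morphJ py conj1g.
have not_translate k w : p w <> p (t ^+ k) -> in_translate k w = false.
  by move=> pw; apply/negP => /in_translate_p.
have pt k l : k <> l -> p (t ^+ k) <> p (t ^+ l) by move=> kl /inj_t.
have ptE k : k <> 0%N -> 1 <> p (t ^+ k).
  by move=> k0; rewrite -(morph1 p) -(expg0 t); apply: pt => /esym.
have x_fix : cycle_inv x = x.
  rewrite /cycle_inv (not_translate 2%N) ?px; last exact: ptE.
  rewrite (not_translate 1%N) ?px; last exact: ptE.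
  rewrite orbF ifN //; apply/negP => /asboolP.
  by rewrite expg0 invg1 mul1g.
have one_t : cycle_inv 1 = t.
  rewrite /cycle_inv (not_translate 2); last by rewrite morph1; exact: ptE.
  have -> : in_translate 0 1 by apply/asboolP; rewrite expg0 invg1 mulg1; exact: sH.1.
  by rewrite mulg1.
have ptz : p (t * z) = p (t ^+ 1) by rewrite gmulfM pz mulg1 expg1.
have tz_fix : cycle_fun (t * z) = t * z.
  rewrite /cycle_fun (not_translate 0); last by rewrite ptz; exact: pt.
  rewrite (not_translate 2); last by rewrite ptz; exact: pt.
  rewrite orbF ifN // -{1}[t]expg1 (in_translateM 1 0); apply/negP => /asboolP.
  by rewrite expg0 invg1 mul1g.
move=> /(congr1 (fun f : selfbij G => p (f 1))).
rewrite !selfbijM !selfbijV /= mul1g x_fix one_t tz_fix gmulfM px mulg1 ptz.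
have pxz : p (x * z) = 1 by rewrite gmulfM px pz mulg1.
case: (cycle_funE (x * z)) => [[_ ->]|[w w01 [xzE _]]|[_ ->]].
- by rewrite gmulfM pxz mulg1; apply: pt.
- have pS k : p w = p (t ^+ k) -> False.
    by move=> E; apply: (@ptE k.+1) => //; rewrite expgS gmulfM -E -gmulfM -xzE pxz.
  by case/orP: w01 => /in_translate_p /pS.
- by rewrite pxz; exact: ptE.
Qed.

End ThreeCycle.

(** * Stability of a window of conjugates *)

Section OneSided.
Variables (G T : groupType) (p : {multiplicative G -> T}) (t : G).
Variables (I : finType) (u : I -> G) (idx : G -> I) (J : finType) (a : J -> G).
Hypothesis tr : coset_transversal p t u idx.
Hypothesis inj_t : forall m n, p (t ^+ m) = p (t ^+ n) -> m = n.
Hypothesis aP : kernel_generators p t a.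
Hypothesis abK : forall x y, p x = 1 -> p y = 1 -> commute x y.

(** A window of [n] consecutive conjugates of the generators, in the role of the subgroup [H]
    above. *)
Definition level n : set G :=
  generated [set g | exists e j, (e < n)%N /\ g = a j ^ t ^- e].

Lemma level_subgroup n : subgroup (level n).
Proof. exact: generated_subgroup. Qed.

Lemma level_gen n e j : (e < n)%N -> level n (a j ^ t ^- e).
Proof. by move=> lt_en; apply: generated_gen; exists e, j. Qed.

Lemma level_min n (P : set G) : subgroup P ->
  (forall e j, (e < n)%N -> P (a j ^ t ^- e)) -> forall x, level n x -> P x.
Proof. by move=> sP aPP x; apply; split=> // _ [e [j [lt_en ->]]]; exact: aPP. Qed.

Lemma conj_subgroup (P : set G) g : subgroup P -> subgroup [set x | P (x ^ g)].
Proof.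
move=> [P1 PF]; split=> [|x y Px Py] /=; first by rewrite conj1g.
by rewrite conjMg conjVg; exact: PF.
Qed.

Lemma level_mono m n x : (m <= n)%N -> level m x -> level n x.
Proof.
move=> le_mn; apply: level_min (level_subgroup n) _ x => e j lt_em.
by apply: level_gen; exact: leq_trans le_mn.
Qed.

Lemma level_p n x : level n x -> p x = 1.
Proof.
apply: (@level_min n [set x | p x = 1]).
  by split=> [|y z /= py pz] /=; rewrite ?morph1 // morphF py pz mulgV.
by move=> e j _ /=; rewrite morphJ aP.1 conj1g.
Qed.

Lemma level_shift n x : level n x -> level n.+1 (x ^ t^-1).
Proof.
apply: (@level_min n [set x | level n.+1 (x ^ t^-1)]).
  exact/conj_subgroup/level_subgroup.
move=> e j lt_en /=; rewrite -conjgM -invgM -expgS; exact: level_gen.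
Qed.

Definition gen_val (z : option J) : G := if z is Some j then a j else t.

Section Action.
Variable N : nat.

Definition act_t : selfbij G := twisted_t inj_t (@level_p N).

Definition act_val (z : option J) : selfbij G :=
  if z is Some j then right_mul (a j) else act_t.

(** Only conjugates with exponents below [e] have to lie in [level N], which is why [e = N] is
    allowed. *)
Lemma act_t_right_mul e j : (e <= N)%N ->
  act_t ^+ e * right_mul (a j) = right_mul (a j ^ t ^- e) * act_t ^+ e.
Proof.
elim: e => [|e IH] le_eN; first by rewrite !expg0 mul1g mulg1 invg1 conjg1.
rewrite expgS -mulgA IH ?(ltnW le_eN) // mulgA twisted_right_mul.
- by rewrite -mulgA -conjgM -invgM -!expgS.
- exact: level_subgroup.
- exact: level_gen.
Qed.

(** The exponent of [t] starts at [b], never becomes negative, and is at most [N] whenever a letter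
    [a j] is read. In this range action and group obey the same rule, so the same [x] and [b']
    describe both. *)
Lemma act_short_word (v : word (option J)) b : (size v <= b)%N -> (b + size v <= N.+1)%N ->
  exists x b', [/\ level N.+1 x,
    act_t ^+ b * word_eval act_val v = right_mul x * act_t ^+ b'
    & t ^+ b * word_eval gen_val v = x * t ^+ b'].
Proof.
elim: v b => [|[z c] v IH] b /= le_vb le_bv.
  exists 1, b; rewrite !word_eval_nil !mulg1 right_mul1 !mul1g; split=> //.
  exact: (level_subgroup _).1.
rewrite !word_eval_cons !mulgA; case: z => [j|]; last first.
  rewrite /letter_eval /=; case: c.
    have [||x [b' [lx Ex Gx]]] := IH b.-1; [by lia..|].
    exists x, b'; rewrite -Ex -Gx; case: b le_vb {IH le_bv Ex Gx} => // b _.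
    by split=> //; rewrite expgSr mulgK.
  have [||x [b' [lx Ex Gx]]] := IH b.+1; [by lia..|].
  by exists x, b'; rewrite -Ex -Gx !expgSr.
have [||x [b' [lx Ex Gx]]] := IH b; [by lia..|].
have [y [ly Ey Gy]] : exists y, [/\ level N.+1 y,
    act_t ^+ b * letter_eval act_val (Some j, c) = right_mul y * act_t ^+ b &
    t ^+ b * letter_eval gen_val (Some j, c) = y * t ^+ b].
  have lt_bN : (b < N.+1)%N by lia.
  have E := act_t_right_mul j lt_bN; rewrite /letter_eval /=; case: c.
    exists (a j ^ t ^- b)^-1; split; last by rewrite [LHS]conjgCV conjVg.
      exact: (subgroupV (level_subgroup _)) (level_gen _ lt_bN).
    rewrite right_mulV; apply: (mulgI (right_mul (a j ^ t ^- b))).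
    by rewrite mulVKg mulgA -E mulgK.
  exists (a j ^ t ^- b); split=> //; first exact: level_gen.
  by rewrite [LHS]conjgCV.
exists (y * x), b'; split; first exact: (subgroupM (level_subgroup _)).
  by rewrite Ey -mulgA Ex right_mulM mulgA.
by rewrite Gy -mulgA Gx mulgA.
Qed.

(** The word is read from exponent [size v]. In the group, [p] forces [b' = size v] and then
    [x = 1]; the action follows. *)
Lemma act_relation (v : word (option J)) : (2 * size v <= N)%N ->
  word_eval gen_val v = 1 -> word_eval act_val v = 1.
Proof.
move=> le_vN v1; have [|x [b' [lx Ex]]] := act_short_word (leqnn (size v)); first by lia.
rewrite v1 mulg1 => Gx.
have bb' : size v = b'.
  by apply: inj_t; rewrite Gx gmulfM (level_p lx) mul1g.
have x1 : x = 1 by apply: (mulIg (t ^+ b')); rewrite -Gx mul1g bb'.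
by move: Ex; rewrite x1 right_mul1 mul1g -bb' => /(canRL (mulKg _)); rewrite mulVg.
Qed.

End Action.

Lemma gen_val_words g : exists w, g = word_eval gen_val w * u (idx g).
Proof.
have sW := words_subgroup gen_val; have WM := subgroupM sW; have WX := subgroupX sW.
have [x [m [n [px gE]]]] := same_cosetP (transversal_coset tr g).
have wt : [set g | exists w, g = word_eval gen_val w] t.
  by exists [:: (None, false)]; rewrite word_eval_seq1.
suff [w xE] : [set g | exists w, g = word_eval gen_val w] (x * t ^- m * t ^+ n).
  by exists w; rewrite -xE.
apply: (WM); last exact: WX.
apply: (WM); last by apply: (subgroupV sW); exact: WX.
have [D [W ->]] := aP.2 x px.
have wJ y e : [set g | exists w, g = word_eval gen_val w] y ->
    [set g | exists w, g = word_eval gen_val w] (y ^ t ^- e).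
  move=> wy; rewrite conjgE invgK; apply: (WM); first exact: WX.
  by apply: (WM) => //; apply: (subgroupV sW); exact: WX.
rewrite conjgE; apply: (WM); first by apply: (subgroupV sW); exact: WX.
apply: (WM); last exact: WX.
elim: W => [|[[c e] j] W IH]; first by rewrite mword_eval_nil; exact: sW.1.
rewrite mword_eval_cons; apply: (WM) => //; apply: wJ => /=.
have wa : [set g | exists w, g = word_eval gen_val w] (a j).
  by exists [:: (Some j, false)]; rewrite word_eval_seq1.
by case: c => //; exact: (subgroupV sW).
Qed.

Lemma gen_val_coset w g : idx (word_eval gen_val w * g) = idx g.
Proof.
apply: (transversal_eq tr); rewrite /same_coset -mulgA mulgV mulg1.
have sg := @generated_subgroup T [set p t].
elim: w => [|[z c] w IH]; first by rewrite word_eval_nil morph1; exact: sg.1.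
rewrite word_eval_cons gmulfM; apply: (subgroupM sg) => //.
have gz : generated [set p t] (p (gen_val z)).
  by case: z => [j|] /=; [rewrite aP.1; exact: sg.1|exact: generated_gen].
by case: c => //=; rewrite /letter_eval /= ?morphV //; exact: (subgroupV sg).
Qed.

(** * The action induced on finitely many copies of the group *)

Section Induced.
Variables (X : finType) (R : set (free_group X)) (phi : {multiplicative free_group X -> G}).
Hypothesis presR : finite_presentation R phi.

Definition pres_gen (x : X) : G := phi (fg_gen x).

Lemma phi_word w : phi (word_eval (@fg_gen X) w) = word_eval pres_gen w.
Proof. exact: word_eval_morph. Qed.

Lemma phi_fg_word e : phi e = word_eval pres_gen (fg_word e).
Proof. by rewrite -phi_word fg_wordK. Qed.

Variable rw1 : I -> letter X -> word (option J).

Definition next (i : I) (v : letter X) : I := idx (u i * letter_eval pres_gen v).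

Hypothesis rw1P : forall i v,
  u i * letter_eval pres_gen v = word_eval gen_val (rw1 i v) * u (next i v).

Fixpoint rw (i : I) (w : word X) : word (option J) :=
  if w is v :: w' then rw1 i v ++ rw (next i v) w' else [::].

Lemma rwP i w :
  u i * word_eval pres_gen w = word_eval gen_val (rw i w) * u (foldl next i w).
Proof.
elim: w i => [|v w IH] i /=; first by rewrite !word_eval_nil mulg1 mul1g.
by rewrite word_eval_cons mulgA rw1P -mulgA IH mulgA -word_eval_cat.
Qed.

Lemma rw_trivial i w : word_eval pres_gen w = 1 ->
  foldl next i w = i /\ word_eval gen_val (rw i w) = 1.
Proof.
move=> w1; have := rwP i w; rewrite w1 mulg1 => E.
have iE : foldl next i w = i.
  by rewrite -[RHS](transversalK tr) E gen_val_coset (transversalK tr).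
by split=> //; apply: (mulIg (u i)); rewrite mul1g [RHS]E iE.
Qed.

(** The number [N] has to exceed finitely many lengths: of rewritten cancelling pairs, so that
    letters act bijectively; of rewritten relators, so that the kernel of [phi] acts trivially; and
    of words for [t] and [a j]. *)
Variables (N : nat) (gen_word : option J -> word X).
Hypothesis short_inv : forall i v, (2 * size (rw i [:: v; (v.1, ~~ v.2)]) <= N)%N.
Hypothesis short_rel : forall r i, R r -> (2 * size (rw i (fg_word r)) <= N)%N.
Hypothesis gen_wordP : forall z, word_eval pres_gen (gen_word z) = gen_val z.
Hypothesis short_gen : forall z, (2 * (size (rw (idx 1) (gen_word z))).+1 <= N)%N.

Local Notation S := (G * I)%type.
Local Notation act := (act_val N).

(** Induction from the preimage of the subgroup generated by [p t]: the second coordinate is the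
    coset, and the rewritten letter moves the first. *)
Definition induced_fun (v : letter X) (x : S) : S :=
  (word_eval act (rw1 x.2 v) x.1, next x.2 v).

Lemma induced_funK v : cancel (induced_fun v) (induced_fun (v.1, ~~ v.2)).
Proof.
move=> [x i]; rewrite /induced_fun /= -selfbijM -word_eval_cat.
have w1 : word_eval pres_gen [:: v; (v.1, ~~ v.2)] = 1.
  by rewrite word_eval_cons word_eval_seq1 letter_eval_neg mulgV.
have [/= -> E] := rw_trivial i w1.
have := act_relation (short_inv i v) E; rewrite /= cats0 => ->.
by [].
Qed.

Lemma induced_funVK v : cancel (induced_fun (v.1, ~~ v.2)) (induced_fun v).
Proof. by have := @induced_funK (v.1, ~~ v.2); rewrite /= negbK; case: v. Qed.

Definition induced (x : X) : selfbij S :=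
  SelfBij (induced_funK (x, false)) (induced_funVK (x, false)).

Lemma inducedE v x : letter_eval induced v x = induced_fun v x.
Proof. by case: v => y []. Qed.

Lemma word_inducedE w x :
  word_eval induced w x = (word_eval act (rw x.2 w) x.1, foldl next x.2 w).
Proof.
elim: w x => [|v w IH] [x i]; first by rewrite !word_eval_nil.
by rewrite word_eval_cons selfbijM inducedE IH /= word_eval_cat.
Qed.

Local Notation theta := (free_group_morphism induced).

Let theta1 : theta 1 = 1. Proof. exact: (morph1 theta). Qed.
Let thetaM x y : theta (x * y) = theta x * theta y. Proof. exact: free_group_morphismM. Qed.
Let thetaV x : theta x^-1 = (theta x)^-1. Proof. exact: (morphV theta). Qed.
Let thetaF x y : theta (x / y) = theta x / theta y. Proof. exact: (morphF theta). Qed.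
Let thetaJ x y : theta (x ^ y) = theta x ^ theta y. Proof. exact: (morphJ theta). Qed.
Let thetaR x y : theta [~ x, y] = [~ theta x, theta y]. Proof. exact: (morphR theta). Qed.

(** The elements acting trivially form a normal subgroup, which contains the relators because their
    rewritten words are short. *)
Lemma induced_trivial e : phi e = 1 -> theta e = 1.
Proof.
move=> /(presentation_kernel presR) /(_ [set e | theta e = 1]); apply; split; first split.
- split=> [|x y /= x1 y1]; first exact: theta1.
  by rewrite thetaF x1 y1 mulgV.
- by move=> x g /= x1; rewrite thetaJ x1 conj1g.
move=> r Rr /=; apply: selfbij_eq => -[x i]; rewrite word_inducedE /=.
have r1 : word_eval pres_gen (fg_word r) = 1.
  rewrite -phi_fg_word; apply/(presentation_kernel presR).
  by move=> P [_ RP]; exact: RP.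
have [-> E] := rw_trivial i r1.
by rewrite (act_relation (short_rel i Rr) E).
Qed.

(** The copy with index [idx 1] is where the twisted action can be observed. *)
Definition realizes (g : G) (f : selfbij G) : Prop :=
  exists e, phi e = g /\ forall x, theta e (x, idx 1) = (f x, idx 1).

Lemma realizesM g1 g2 f1 f2 : realizes g1 f1 -> realizes g2 f2 ->
  realizes (g1 * g2) (f1 * f2).
Proof.
move=> [e1 [<- E1]] [e2 [<- E2]]; exists (e1 * e2); split; first exact: gmulfM.
by move=> x; rewrite thetaM !selfbijM E1 E2.
Qed.

Lemma realizesV g f : realizes g f -> realizes g^-1 f^-1.
Proof.
move=> [e [<- E]]; exists e^-1; split; first exact: morphV.
move=> x; rewrite thetaV !selfbijV.
by rewrite -{1}(selfbijVK f x) -E selfbijK.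
Qed.

Lemma realizes1 : realizes 1 1.
Proof. by exists 1; rewrite morph1; split=> // x; rewrite theta1. Qed.

Lemma realizesX g f n : realizes g f -> realizes (g ^+ n) (f ^+ n).
Proof.
move=> gf; elim: n => [|n IH]; first by rewrite !expg0; exact: realizes1.
by rewrite !expgS; exact: realizesM.
Qed.

Lemma realizesJ g1 g2 f1 f2 : realizes g1 f1 -> realizes g2 f2 ->
  realizes (g1 ^ g2) (f1 ^ f2).
Proof.
by move=> H1 H2; rewrite !conjgE; apply: realizesM (realizesV H2) (realizesM H1 H2).
Qed.

Lemma realizes_gen z : realizes (gen_val z) (act z).
Proof.
exists (word_eval (@fg_gen X) (gen_word z)); rewrite phi_word gen_wordP; split=> // x.
rewrite free_group_morphism_word word_inducedE /=.
have E := rwP (idx 1) (gen_word z); rewrite gen_wordP (transversal1 tr) mul1g in E.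
have zE : idx (gen_val z) = idx 1.
  have := gen_val_coset [:: (z, false)] 1.
  by rewrite word_eval_seq1 mulg1.
have iE : foldl next (idx 1) (gen_word z) = idx 1.
  by rewrite -[RHS]zE E gen_val_coset (transversalK tr).
rewrite iE; congr pair.
(* The rewritten word and the letter [z] agree in the group. Appending the inverse letter, counted
   by the successor in [short_gen], gives a short relation, so they also agree in the action. *)
have {E} : word_eval gen_val (rw (idx 1) (gen_word z) ++ [:: (z, true)]) = 1.
  rewrite word_eval_cat word_eval_seq1 -[letter_eval _ _]/((gen_val z)^-1) E iE.
  by rewrite (transversal1 tr) mulg1 mulgV.
move=> /act_relation; rewrite size_cat addn1 => /(_ _ (short_gen z)).
by rewrite word_eval_cat word_eval_seq1 => /divg1_eq ->.
Qed.

Lemma realizes_level x : level N.+1 x -> realizes x (right_mul x).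
Proof.
apply: (@level_min N.+1 [set x | realizes x (right_mul x)]).
  split; first by rewrite /= right_mul1; exact: realizes1.
  move=> y z /= Hy Hz; rewrite right_mulM right_mulV.
  by apply: realizesM => //; exact: realizesV.
move=> e j lt_eN /=; have rt := realizes_gen None; have ra := realizes_gen (Some j).
have -> : right_mul (a j ^ t ^- e) = right_mul (a j) ^ (act_t N) ^- e.
  by rewrite [RHS]conjgE invgK mulgA act_t_right_mul // mulgK.
by apply: realizesJ => //; apply: realizesV; exact: realizesX.
Qed.

(** If both inclusions fail for [x] and [y], then [x] and [y ^ t] still commute, so the commutator
    of their lifts acts trivially, against [twisted_noncommute]. *)
Lemma induced_one_sided : (forall x, level N.+1 x -> level N x) \/
  (forall x, level N.+1 x -> level N (x ^ t)).
Proof.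
apply: contrapT => /not_orP[/existsNP[x /not_implyP[lx Nx]] /existsNP[y /not_implyP[ly Ny]]].
have NC := @twisted_noncommute _ _ p t _ inj_t (level_subgroup N) (@level_p N) x y
  (level_p lx) (level_p ly).
apply: (NC Nx Ny) => {NC}.
have [e1 [phi1 E1]] := realizes_level lx.
have [e2 [phi2 E2]] := realizesJ (realizes_level ly) (realizes_gen None).
have /induced_trivial : phi ([~ e1, e2]) = 1.
  rewrite morphR phi1 phi2; apply/eqP/commgP/abK; first exact: level_p lx.
  by rewrite morphJ (level_p ly) conj1g.
rewrite thetaR => /eqP/commgP E12; apply: selfbij_eq => z.
have H : theta e2 (theta e1 (z, idx 1)) = theta e1 (theta e2 (z, idx 1)).
  exact: (congr1 (fun f : selfbij S => f (z, idx 1)) E12).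
by move: H; rewrite E1 E2 E2 E1 => -[].
Qed.

End Induced.

Theorem one_sided (X : finType) (R : set (free_group X))
    (phi : {multiplicative free_group X -> G}) : finite_presentation R phi ->
  exists2 n, (0 < n)%N & (forall x, level n x -> level n (x ^ t^-1)) \/
                         (forall x, level n x -> level n (x ^ t)).
Proof.
move=> presR.
have /choice[rw1 rw1P] : forall iv : I * letter X, exists w,
    u iv.1 * letter_eval (pres_gen phi) iv.2 = word_eval gen_val w * u (next phi iv.1 iv.2).
  by move=> iv; exact: gen_val_words.
pose rwf i v := rw1 (i, v).
have [N1 N1P] : exists N1, forall iv : I * (X * bool),
    (2 * size (rw phi rwf iv.1 [:: iv.2; (iv.2.1, ~~ iv.2.2)]) <= N1)%N.
  by apply: uniform_bound => [iv m n le_mn /leq_trans -> //|iv]; eexists; exact: leqnn.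
have [N2 N2P] : exists N2, forall r i, R r -> (2 * size (rw phi rwf i (fg_word r)) <= N2)%N.
  have [/finite_seqP[s ->] _ _] := presR.
  have [N2 N2P] : exists N2, forall ir : I * seq_sub s,
      (2 * size (rw phi rwf ir.1 (fg_word (val ir.2))) <= N2)%N.
    by apply: uniform_bound => [ir m n le_mn /leq_trans -> //|ir]; eexists; exact: leqnn.
  by exists N2 => r i sr; exact: (N2P (i, SeqSub sr)).
have lift := morph_lift (let: And3 _ r _ := presR in r).
have /choice[c cP] : forall z, exists w, word_eval (pres_gen phi) w = gen_val z.
  by move=> z; have [e <-] := lift (gen_val z); exists (fg_word e); rewrite -phi_fg_word.
have [N3 N3P] : exists N3, forall z, (2 * (size (rw phi rwf (idx 1) (c z))).+1 <= N3)%N.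
  by apply: uniform_bound => [z m n le_mn /leq_trans -> //|z]; eexists; exact: leqnn.
(* The successor makes the window nonempty. *)
pose N := (N1 + N2 + N3).+1.
have [|||||H|H] := @induced_one_sided X R phi presR rwf _ N c.
- by move=> i v; exact: (rw1P (i, v)).
- by move=> i v; apply: leq_trans (N1P (i, v)) _; rewrite /N; lia.
- by move=> r i Rr; apply: leq_trans (N2P r i Rr) _; rewrite /N; lia.
- exact: cP.
- by move=> z; apply: leq_trans (N3P z) _; rewrite /N; lia.
(* In the first case a shifted element of the smaller window falls back into it; in the second the
   larger window is shifted into the smaller one. *)
- by exists N => //; left=> x /level_shift /H.
- by exists N.+1 => //; right=> x /H; exact: level_mono.
Qed.

End OneSided.

(** * Dehn functions *)

Section Exponential.
Variables (E : groupType) (R : set E) (J : finType) (s : E) (b : J -> E) (k q : nat).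
Hypothesis q_gt1 : (1 < q)%N.
Hypothesis commute_b : forall i j, commute_a R k (b i) (b j).
Hypothesis conj_b : forall j, exists W, [/\ below 1 W, (size W <= q)%N
  & eqa R k (b j ^ s^-1) (mword_eval s b W)].

Lemma conj_mword W : below 1 W -> exists W', [/\ below 1 W', (size W' <= q * size W)%N
  & eqa R (k * size W) (mword_eval s b W ^ s^-1) (mword_eval s b W')].
Proof.
elim: W => [|[[c e] j] W IH] bW.
  by exists [::]; rewrite mword_eval_nil conj1g; split=> //; exact: eqa_refl.
have [|W' [bW' sW' eW']] := IH; first by move=> x Wx; apply: bW; rewrite inE Wx orbT.
have e0 : e = 0%N by have := bW _ (mem_head _ _); rewrite /=; lia.
have [Wj [bWj sWj eWj]] := conj_b j.
exists ((if c then mword_inv Wj else Wj) ++ W'); split.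
- by apply: below_cat => //; case: c {bW} => //; exact: below_inv.
- by rewrite size_cat /= mulnS leq_add //; case: c {bW}; rewrite ?size_mword_inv.
rewrite mword_eval_cons mword_eval_cat conjMg /= mulnS; apply: eqaM => //.
rewrite /mletter_eval /= e0 expg0 invg1 conjg1.
by case: c {bW}; rewrite ?mword_eval_inv ?conjVg //; exact: eqaV.
Qed.

(** Each conjugation multiplies the length by at most [q]. The costs form a geometric sum, at most
    [k * q ^ e] since [q] is at least 2. *)
Lemma mletter_level0 c e j : exists W, [/\ below 1 W, (size W <= q ^ e)%N
  & eqa R (k * q ^ e) (mletter_eval s b (c, e, j)) (mword_eval s b W)].
Proof.
elim: e => [|e [W [bW sW eW]]].
  exists [:: (c, 0%N, j)]; split=> [x||]; first by rewrite inE => /eqP ->.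
    by rewrite expn0.
  by rewrite mword_eval_cons mword_eval_nil mulg1; exact: eqa_refl.
have [W' [bW' sW' eW']] := conj_mword bW; exists W'; split=> //.
  by apply: leq_trans sW' _; rewrite expnS leq_mul2l sW orbT.
rewrite -addn1 mletter_eval_shift expg1.
apply: eqaW (eqa_trans (eqaJ s^-1 eW) eW').
apply: (@leq_trans (k * q ^ e + k * q ^ e)); first by rewrite leq_add2l leq_mul2l sW orbT.
by rewrite -mulnDr leq_mul2l addn1 expnS addnn -mul2n leq_mul2r q_gt1 !orbT.
Qed.

Lemma commute_level0 W1 W2 : below 1 W1 -> below 1 W2 ->
  commute_a R (size W2 * (size W1 * k)) (mword_eval s b W1) (mword_eval s b W2).
Proof.
move=> b1 b2; apply: commute_a_prod => y W2y; apply: commute_a_sym.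
apply: commute_a_prod => x W1x; apply: (@commute_a_mletters _ R J s b k 1%N).
- by case=> // i j _; rewrite expg0 conjg1.
- exact: b2.
- exact: b1.
Qed.

Lemma commute_mletters_exp M x y : (x.1.2 < M)%N -> (y.1.2 < M)%N ->
  commute_a R (5 * k * (q ^ M * q ^ M)) (mletter_eval s b x) (mletter_eval s b y).
Proof.
case: x y => [[c e] j] [[c' e'] j'] /= lt_e lt_e'.
have [W [bW sW eW]] := mletter_level0 c e j.
have [W' [bW' sW' eW']] := mletter_level0 c' e' j'.
(* Two replacements on each side and one commutation, each at most [k * (q ^ M * q ^ M)], give the
   factor 5. *)
apply: commute_aW (commute_a_eqa eW eW' (commute_level0 bW bW')).
have le_q i : (i < M)%N -> (q ^ i <= q ^ M)%N by move=> lt_iM; rewrite leq_exp2l // ltnW.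
have := le_q _ lt_e; have := le_q _ lt_e'; have : (0 < q ^ M)%N by rewrite expn_gt0; lia.
move: (q ^ M)%N (q ^ e)%N (q ^ e')%N sW sW' => Q Qe Qe' sW sW' Q_gt0 leQ' leQ.
have H1 : (k * Qe <= k * (Q * Q))%N.
  by rewrite leq_mul2l; apply/orP; right; apply: leq_trans leQ _; rewrite leq_pmull.
have H2 : (k * Qe' <= k * (Q * Q))%N.
  by rewrite leq_mul2l; apply/orP; right; apply: leq_trans leQ' _; rewrite leq_pmull.
have H3 : (size W' * (size W * k) <= k * (Q * Q))%N.
  rewrite mulnA mulnC leq_mul2l; apply/orP; right; apply: leq_mul.
    exact: leq_trans leQ'.
  exact: leq_trans leQ.
rewrite -mulnA; move: (k * (Q * Q))%N H1 H2 H3 => Z; lia.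
Qed.

End Exponential.

Section FinitelyPresented.
Variables (G T : groupType) (p : {multiplicative G -> T}) (t : G).
Variables (I : finType) (u : I -> G) (idx : G -> I) (J : finType) (a : J -> G).
Hypotheses (tr : coset_transversal p t u idx) (tP : infinite_or_trivial p t).
Hypothesis aP : kernel_generators p t a.
Hypothesis abK : forall x y, p x = 1 -> p y = 1 -> commute x y.
Hypothesis conj_a : forall j, exists2 W, below 1 W & a j ^ t^-1 = mword_eval t a W.

Lemma exponential_dehn_bound (X : finType) (R : set (free_group X))
    (phi : {multiplicative free_group X -> G}) : finite_presentation R phi ->
  dehn_le (dehn_function (@fg_gen X) R phi) (fun n => (2 ^ n)%N).
Proof.
move=> presR; have [d area_d] := area_bound tr tP aP.
have [s [b [C [phis phib areaC]]]] := area_d _ X (@fg_gen X) R phi presR.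
have kerR := presentation_kernel presR.
have eqa_phi x y : phi x = phi y -> exists l, eqa R l x y.
  by move=> xy; apply: eqa_exists; apply/kerR; rewrite morphF xy mulgV.
have evE W : phi (mword_eval s b W) = mword_eval t a W.
  rewrite mword_eval_morph phis; congr mword_eval; exact/funext.
have [k1 k1P] : exists k, forall ij : J * J, commute_a R k (b ij.1) (b ij.2).
  apply: uniform_bound => [ij m n le_mn|[i j]]; first exact: commute_aW.
  by apply: eqa_phi; rewrite !gmulfM !phib; apply: abK; exact: aP.1.
have [k2 k2P] : exists k, forall j, exists W, [/\ below 1 W, (size W <= k)%N
    & eqa R k (b j ^ s^-1) (mword_eval s b W)].
  apply: uniform_bound => [j m n le_mn [W [bW sW eW]]|j].
    by exists W; split=> //; [exact: leq_trans le_mn|exact: eqaW eW].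
  have [W bW aW] := conj_a j; have [|l lW] := eqa_phi (b j ^ s^-1) (mword_eval s b W).
    by rewrite evE morphJ morphV phis phib.
  exists (size W + l)%N, W; split=> //; first exact: leq_addr.
  by apply: eqaW lW; exact: leq_addl.
have [k [le_k1 le_k2]] : exists k, (k1 <= k)%N /\ (k2 <= k)%N by exists (k1 + k2)%N; lia.
have [q [q_gt1 le_q2]] : exists q, (1 < q)%N /\ (k2 <= q)%N by exists k2.+2; lia.
have comm := @commute_mletters_exp _ R J s b k q q_gt1.
have bound n : (dehn_function (@fg_gen X) R phi n <=
    C * n.+2 ^ d * (5 * k * (q ^ (C * n.+1) * q ^ (C * n.+1))).+1)%N.
  apply: dehn_function_le => w le_wn pw1; apply: areaC le_wn pw1 => x y xM yM.
  apply: comm => // [i j|j].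
    exact: commute_aW (k1P (i, j)).
  have [W [bW sW eW]] := k2P j; exists W; split=> //; first exact: leq_trans le_q2.
  exact: eqaW eW.
(* The exponent collects [n.+2 <= 2 ^ n.+1] and, twice, [q ^ m <= 2 ^ (q * m)]. *)
pose r := (d + q * C + q * C)%N.
exists (C * (5 * k).+1 * 2 ^ r + r).+1 => // n.
apply: leq_trans (bound n) _.
have le_n2 : (n.+2 <= 2 ^ n.+1)%N by exact: ltn_expl.
have {}le_n2 : (n.+2 ^ d <= 2 ^ (d * n.+1))%N.
  by rewrite mulnC expnM; case: (d) => // d'; rewrite leq_exp2r.
have le_q : (q ^ (C * n.+1) <= 2 ^ (q * C * n.+1))%N.
  rewrite -mulnA [leqRHS]expnM; case: (C * n.+1)%N => // m.
  by rewrite leq_exp2r // ltnW // ltn_expl.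
set K := (C * (5 * k).+1)%N.
apply: (@leq_trans (K * 2 ^ (r * n.+1))).
  have : (0 < 2 ^ (q * C * n.+1))%N by rewrite expn_gt0.
  rewrite /K; move: (5 * k)%N => z; rewrite /r !mulnDl !expnD; move: le_n2 le_q.
  move: (n.+2 ^ d)%N (2 ^ (d * n.+1))%N (q ^ _)%N (2 ^ (q * C * n.+1))%N.
  move=> x X' y Y le_x le_y Y_gt0.
  rewrite -!mulnA leq_mul2l; apply/orP; right.
  rewrite [leqRHS]mulnCA; apply: leq_mul => //.
  have le_yy := leq_mul le_y le_y.
  apply: (@leq_trans (z * (Y * Y)).+1).
    by rewrite ltnS leq_mul2l le_yy orbT.
  rewrite mulSn -[leqLHS]add1n; apply: leq_add => //; by rewrite muln_gt0 Y_gt0.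
rewrite mulnS expnD mulnA; set C' := (_ + r).+1.
apply: (@leq_trans (C' * 2 ^ (C' * n))); last by rewrite -addnA leq_addr.
apply: leq_mul; first by rewrite /C' leqW // leq_addr.
by rewrite leq_exp2l // leq_mul2r /C' leqW ?orbT // leq_addl.
Qed.

End FinitelyPresented.

(** * Windows as generating families *)

Section OneSidedGenerators.
Variables (G T : groupType) (p : {multiplicative G -> T}) (t : G).
Variables (I : finType) (u : I -> G) (idx : G -> I) (J : finType) (a : J -> G).

Lemma generated_inv (S : groupType) (s : S) : generated [set s^-1] = generated [set s].
Proof.
apply/seteqP; split=> x; apply; split; try exact: generated_subgroup.
  by move=> _ ->; apply: (subgroupV (generated_subgroup _)); exact: generated_gen.
move=> _ ->; rewrite -[X in generated _ X]invgK.
by apply: (subgroupV (generated_subgroup _)); exact: generated_gen.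
Qed.

Lemma coset_transversal_inv : coset_transversal p t u idx -> coset_transversal p t^-1 u idx.
Proof.
have E x y : same_coset p t^-1 x y = same_coset p t x y.
  by rewrite /same_coset morphV generated_inv.
by case=> H1 H2 H3 H4; split=> // [g|g h]; rewrite E //; exact: H2.
Qed.

Lemma infinite_or_trivial_inv : infinite_or_trivial p t -> infinite_or_trivial p t^-1.
Proof.
case=> [inj|->]; last by right; rewrite invg1.
by left=> m n; rewrite !expVgn !morphV => /invg_inj /inj.
Qed.

(** Replacing [e] by [D + M - e] exchanges [t] and its inverse; the bound [M] keeps exponents
    nonnegative. *)
Lemma kernel_generators_inv : kernel_generators p t a -> kernel_generators p t^-1 a.
Proof.
move=> [pa aG]; split=> // x /aG[D [W ->]]; have [M bW] := below_exists W.
exists M, [seq (y.1.1, D + M - y.1.2, y.2)%N | y <- W].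
rewrite /mword_eval big_map !conjg_prod !big_seq; apply: eq_bigr => -[[c e] j] /bW /= lt_eM.
rewrite /mletter_eval /= -!conjgM; congr (_ ^ _); rewrite !expVgn invgK.
have [m ->] : exists m, (M = e + m)%N by exists (M - e)%N; lia.
have -> : (D + (e + m) - e = D + m)%N by lia.
rewrite !expgnDr invgM !mulgA mulgK.
by apply: commute_sym; apply: commuteV; exact: commuteX2.
Qed.

(** The whole window becomes the generating family, so its stability under conjugation is the
    condition required for the exponential bound. *)
Definition level_basis n (ej : 'I_n * J) : G := a ej.2 ^ t ^- ej.1.

(** Letters of exponent 0 do not depend on [s], so one word serves for both [t] and its inverse. *)
Lemma level_mword n x : level t a n x ->
  exists2 W : seq (mletter ('I_n * J)%type), below 1 W
    & forall s, x = mword_eval s (@level_basis n) W.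
Proof.
apply: (@level_min G t J a n [set x | exists2 W : seq (mletter ('I_n * J)%type), below 1 W
    & forall s, x = mword_eval s (@level_basis n) W]).
  split; first by exists [::] => // s; rewrite mword_eval_nil.
  move=> y z [W1 b1 yE] [W2 b2 zE]; exists (W1 ++ mword_inv W2).
    by apply: below_cat => //; exact: below_inv.
  by move=> s; rewrite mword_eval_cat mword_eval_inv -yE -zE.
move=> e j lt_en; exists [:: (false, 0%N, (Ordinal lt_en, j))].
  by move=> y; rewrite inE => /eqP ->.
by move=> s; rewrite mword_eval_cons mword_eval_nil mulg1 /mletter_eval /= expg0 invg1 conjg1.
Qed.

Lemma level_kernel_generators n : (0 < n)%N -> kernel_generators p t a ->
  kernel_generators p t (@level_basis n).
Proof.
move=> n_gt0 [pa aG]; split=> [[e j]|x /aG[D [W ->]]].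
  by rewrite morphJ pa conj1g.
exists D, [seq (y.1, (Ordinal n_gt0, y.2)) | y <- W]; congr (_ ^ _).
rewrite /mword_eval big_map; apply: eq_bigr => -[[c e] j] _.
by rewrite /mletter_eval /level_basis /= expg0 invg1 conjg1.
Qed.

End OneSidedGenerators.

Section FinitelyPresentedBound.
Variables (G T : groupType) (p : {multiplicative G -> T}) (t : G).
Variables (I : finType) (u : I -> G) (idx : G -> I) (J : finType) (a : J -> G).
Hypotheses (tr : coset_transversal p t u idx) (tP : infinite_or_trivial p t).
Hypothesis aP : kernel_generators p t a.
Hypothesis abK : forall x y, p x = 1 -> p y = 1 -> commute x y.

(** One finite presentation yields the stable window; the bound then follows for each. If the window
    is stable under conjugation by [t] rather than by its inverse, [t] is replaced by its
    inverse. *)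
Lemma finitely_presented_dehn_bound : finitely_presented G ->
  forall (X : finType) (R : set (free_group X)) (phi : {multiplicative free_group X -> G}),
  finite_presentation R phi ->
  dehn_le (dehn_function (@fg_gen X) R phi) (fun n => (2 ^ n)%N).
Proof.
move=> [X0 [R0 [phi0 pres0]]] X R phi presR.
have [inj_t|t1] := tP; last first.
  apply: (exponential_dehn_bound tr tP aP abK _ presR) => j.
  exists [:: (false, 0%N, j)]; first by move=> x; rewrite inE => /eqP ->.
  by rewrite mword_eval_cons mword_eval_nil mulg1 /mletter_eval /= t1 expg0 invg1.
have [n n_gt0 [up|down]] := one_sided tr inj_t aP abK pres0.
  have bP := level_kernel_generators n_gt0 aP.
  apply: (exponential_dehn_bound tr tP bP abK _ presR) => -[e j].
  have [W bW WE] := level_mword (up _ (@level_gen G t J a n e j (ltn_ord e))).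
  by exists W.
have bP := kernel_generators_inv (level_kernel_generators n_gt0 aP).
apply: (exponential_dehn_bound (coset_transversal_inv tr) (infinite_or_trivial_inv tP)
  bP abK _ presR) => -[e j]; rewrite invgK.
have [W bW WE] := level_mword (down _ (@level_gen G t J a n e j (ltn_ord e))).
by exists W.
Qed.

End FinitelyPresentedBound.

Theorem theoremB (A G T : groupType)
    (i : {multiplicative A -> G}) (p : {multiplicative G -> T})
    (fgG : finitely_generated G) (mG : metabelian_group G)
    (abA : abelian_group A) (abT : abelian_group T) (vcT : virtually_cyclic T)
    (exG : short_exact i p) :
  (exists d : nat,
     forall (X : finType) (R : set (free_metabelian X))
       (phi : {multiplicative free_metabelian X -> G}),
       finite_presentation R phi ->
       dehn_le (dehn_function (@fm_gen X) R phi) (fun n => (n ^ d)%N))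
  /\
  (finitely_presented G ->
     forall (X : finType) (R : set (free_group X))
       (phi : {multiplicative free_group X -> G}),
       finite_presentation R phi ->
       dehn_le (dehn_function (@fg_gen X) R phi) (fun n => (2 ^ n)%N)).
Proof.
have [_ kerp surj] := exG.
have abK x y : p x = 1 -> p y = 1 -> commute x y.
  move=> px py; have [x' _ <-] : range i x by rewrite kerp.
  have [y' _ <-] : range i y by rewrite kerp.
  by rewrite /commute -!gmulfM abA.
have [t [I [u [idx [tP tr]]]]] := virtually_cyclic_transversal surj vcT.
have [Y [y y_gen]] := finitely_generated_word fgG.
have [J [a aP]] := kernel_generators_exist tr tP y_gen.
split; first exact: relative_dehn_bound tr tP aP abK.
exact: finitely_presented_dehn_bound tr tP aP abK.
Qed.
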